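(* Let $G$ be a Lie group with Lie algebra $\mathfrak g$ and let $k\ge1$. With respect to the action of the symmetric group $S_k$ on the $k$-th order tangent group $T^kG$ (in the right trivialization) given by $$\sigma\cdot\left(g,(\varepsilon^\alpha x_\alpha)_{\alpha\in I_k^*}\right)=\left(g,(\varepsilon^{\sigma(\alpha)}x_\alpha)_{\alpha\in I_k^*}\right),\qquad\sigma\in S_k,$$ the fixed point set $(T^kG)^{S_k}$ is a subgroup of $T^kG$, isomorphic to the jet group $J^kG$.
   Context: Tangent group: $T^kG=T(T^{k-1}G)$, $T^0G=G$, is the iterated tangent bundle of $G$ with its natural Lie group structure (the iterated tangent functor applied to the group operations of $G$). Let $I_k$ be the power set of $\{1,\dots,k\}$ and $I_k^*=I_k\setminus\{\emptyset\}$. Using the right trivialization of each tangent bundle $T(T^{j-1}G)\cong T^{j-1}G\times\varepsilon_jT^{j-1}\mathfrak g$ (where $T^{j-1}\mathfrak g$ is the Lie algebra of $T^{j-1}G$, and the infinitesimal units $\varepsilon_1,\dots,\varepsilon_k$ are formal labels keeping track of each step), one gets the right trivialization $T^kG=G\times\bigoplus_{\alpha\in I_k^*}\varepsilon^\alpha\mathfrak g$, where $\varepsilon^\alpha=\varepsilon_{\alpha_n}\cdots\varepsilon_{\alpha_1}$ for $\alpha=\{\alpha_1<\dots<\alpha_n\}$. Thus elements of $T^kG$ are written $(g,(\varepsilon^\alpha x_\alpha)_{\alpha\in I_k^*})$ with $g\in G$ and $x_\alpha\in\mathfrak g$. In this trivialization the group multiplication is known to be $$(g,(\varepsilon^\alpha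 x_\alpha)_{\alpha\in I_k^*})(h,(\varepsilon^\alpha y_\alpha)_{\alpha\in I_k^*})=(gh,(\varepsilon^\alpha z_\alpha)_{\alpha\in I_k^*}),\qquad z_\alpha=x_\alpha+\sum_{\lambda\in\mathcal P(\alpha)}\operatorname{ad}_{x_{\lambda_{\ell-1}}}\cdots\operatorname{ad}_{x_{\lambda_1}}\operatorname{Ad}_gy_{\lambda_\ell},$$ where $\mathcal P(\alpha)$ is the set of all partitions $\lambda=\lambda_1|\dots|\lambda_\ell$ of the set $\alpha$ into nonempty disjoint subsets, each ordered anti-lexicographically (i.e. $\max\lambda_1<\dots<\max\lambda_\ell$), and $\ell$ is the length of $\lambda$. Here $\operatorname{ad}_xy=[x,y]$ and $\operatorname{Ad}$ is the adjoint action. In the action, $\sigma(\alpha)$ is the image of the subset $\alpha$ under $\sigma$; i.e. the $\sigma(\alpha)$-component of $\sigma\cdot(g,(\varepsilon^\alpha x_\alpha))$ is $x_\alpha$. Jet group: $J^kG$ is the manifold of $k$-jets $j^kc$ at $0$ of smooth curves $c$ in $G$, a Lie group under $(j^kc)(j^kb):=j^k(cb)$ (pointwise product of curves). *)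

(* Defs.v *)
From mathcomp Require Import all_boot all_order all_algebra all_fingroup.
From mathcomp Require Import all_classical all_reals all_analysis.
Import Order.TTheory GRing.Theory Num.Theory numFieldNormedType.Exports.

Set Implicit Arguments.
Unset Strict Implicit.
Unset Printing Implicit Defensive.

Local Open Scope classical_set_scope.
Local Open Scope ring_scope.

Section Smooth.
Context {R : realType} {V W : normedModType R}.

Definition iter_derive (vs : seq V) (f : V -> W) : V -> W :=
  foldr (fun v g x => 'D_v g x) f vs.

(* [f] is C^oo on a neighbourhood of [x]: the neighbourhood does not depend on
   the list of directions [vs]. In finite dimension this is the usual notion. *)
Definition smooth (f : V -> W) (x : V) : Prop :=
  \forall y \near x, forall vs, differentiable (iter_derive vs f) y.

Lemma smooth_cst (a : W) (x : V) : smooth (cst a) x.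
Proof.
have iterE vs : exists b, iter_derive vs (cst a) = cst b.
  elim: vs => [|v vs [b IHb]]; first by exists a.
  by exists 0; apply/funext => y; rewrite /= IHb derive_cst.
by apply: nearW => y vs; have [b ->] := iterE vs; exact: differentiable_cst.
Qed.

End Smooth.

(* A chart is a map [chart_map] from [source] onto the open set [target], with
   inverse [param]; both are total functions, meaningless outside these sets. *)
Record chart (R : realType) (M : Type) (n : nat) := Chart {
  source : set M;
  target : set 'rV[R]_n;
  chart_map : M -> 'rV[R]_n;
  param : 'rV[R]_n -> M }.

(* Manifolds and Lie groups are split into data and laws ([is_manifold],
   [is_lie_group]): jet spaces and iterated tangent bundles are constructed as
   data, and their laws follow from those of the base. The topology of a
   manifold is the one induced by its atlas. *)
Record manifold (R : realType) := Manifold {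
  carrier :> Type;
  mdim : nat;
  atlas : set (chart R carrier mdim) }.

Section ManifoldTheory.
Context {R : realType}.
Implicit Types M N : manifold R.

Definition charts_at M (p : M) : set (chart R M (mdim M)) :=
  [set phi | atlas phi /\ source phi p].

Definition mopen M (U : set M) : Prop :=
  forall phi, atlas (m := M) phi -> open (target phi `&` param phi @^-1` U).

Definition smooth_into (V : normedModType R) M (f : V -> M) (x : V) : Prop :=
  forall phi, charts_at (f x) phi ->
    (\forall y \near x, source phi (f y)) /\ smooth (chart_map phi \o f) x.

Definition msmooth M N (f : M -> N) (p : M) : Prop :=
  forall phi, charts_at p phi -> smooth_into (f \o param phi) (chart_map phi p).

(* Smoothness of a map on an arbitrary subset of a manifold: local existence of
   smooth extensions. *)
Definition msmooth_on M N (S : set M) (f : M -> N) : Prop :=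
  forall p, S p -> exists (F : M -> N) (U : set M),
    [/\ msmooth F p, mopen U, U p & {in U `&` S, F =1 f}].

Record is_manifold M : Prop := IsManifold {
  mfd_cover : forall p : M, exists phi, charts_at p phi;
  mfd_open_target : forall phi, atlas (m := M) phi -> open (target phi);
  mfd_coord : forall phi, atlas (m := M) phi -> forall p, source phi p ->
    target phi (chart_map phi p) /\ param phi (chart_map phi p) = p;
  mfd_param : forall phi, atlas (m := M) phi -> forall x, target phi x ->
    source phi (param phi x) /\ chart_map phi (param phi x) = x;
  (* unfolds to: [psi \o phi^-1] has an open domain and is smooth there *)
  mfd_transition : forall (p : M) phi, charts_at p phi ->
    smooth_into (param phi) (chart_map phi p);
  mfd_hausdorff : forall p q : M, p <> q -> exists U1 U2 : set M,
    [/\ mopen U1, mopen U2, U1 p, U2 q & U1 `&` U2 = set0];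
  mfd_second_countable : exists B : nat -> set M, (forall i, mopen (B i)) /\
    forall (U : set M) p, mopen U -> U p -> exists i, B i p /\ B i `<=` U }.

End ManifoldTheory.

Record lieGroup (R : realType) := LieGroup {
  lg_manifold :> manifold R;
  lone : lg_manifold;
  linv : lg_manifold -> lg_manifold;
  lmul : lg_manifold -> lg_manifold -> lg_manifold }.

Section LieGroupTheory.
Context {R : realType}.
Implicit Types G H : lieGroup R.

Record is_lie_group G : Prop := IsLieGroup {
  lg_is_manifold : is_manifold G;
  lg_mulA : associative (@lmul R G);
  lg_mul1 : left_id (lone G) (@lmul R G);
  lg_mulV : left_inverse (lone G) (@linv R G) (@lmul R G);
  lg_smooth_mul : forall (p q : G) phi psi, charts_at p phi ->
    charts_at q psi ->
    smooth_into (fun z : 'rV[R]_(mdim G) * 'rV[R]_(mdim G) =>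
                   lmul (param phi z.1) (param psi z.2))
                (chart_map phi p, chart_map psi q);
  lg_smooth_inv : forall p : G, msmooth (@linv R G) p }.

Record is_subgroup G (S : set G) : Prop := IsSubgroup {
  subgroup1 : S (lone G);
  subgroupM : forall p q, S p -> S q -> S (lmul p q);
  subgroupV : forall p, S p -> S (linv p) }.

(* A group isomorphism from [H] onto the subset [S] of [G], smooth in both
   directions. *)
Definition lie_isomorphic_to_subgroup H G (S : set G) : Prop :=
  exists (f : H -> G) (g : G -> H),
    [/\ {morph f : p q / lmul p q >-> lmul p q},
        forall p, S (f p),
        cancel f g,
        {in S, cancel g f} &
        (forall p, msmooth f p) /\ msmooth_on S g].

End LieGroupTheory.

Section Jets.
Context {R : realType} (k : nat).

Section JetManifold.
Variable M : manifold R.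
Implicit Types c b : R -> M.

(* Only the germ at 0 matters: curves need not be smooth away from 0. *)
Definition smooth_curve c : Prop := smooth_into (c : R^o -> M) 0.

Definition same_jet c b : Prop :=
  c 0 = b 0 /\ forall phi, charts_at (c 0) phi -> forall i, (i <= k)%N ->
    derive1n i (chart_map phi \o c) 0 = derive1n i (chart_map phi \o b) 0.

Definition jet_class c : set (R -> M) :=
  [set b | smooth_curve b /\ same_jet c b].

Definition jet : Type :=
  {X : set (R -> M) | exists2 c, smooth_curve c & X = jet_class c}.

Definition jet_rep (X : jet) : R -> M := s2val (cid2 (svalP X)).

Lemma smooth_curve_cst (p : M) : smooth_curve (cst p).
Proof.
move=> phi [_ phip]; split; first exact: (@filterE _ _ (nbhs_filter (0 : R^o))).
exact: (@smooth_cst _ R^o _ (chart_map phi p)).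
Qed.

(* The jet at 0 of a curve [c]; the value on non-smooth curves is irrelevant. *)
Definition jet_of c : jet :=
  match pselect (smooth_curve c) with
  | left cs => exist _ (jet_class c) (ex_intro2 _ _ c cs erefl)
  | right _ => exist _ (jet_class (cst (c 0)))
                 (ex_intro2 _ _ _ (@smooth_curve_cst (c 0)) erefl)
  end.

(* The coordinates of a jet are the derivatives of order 0, ..., k, at 0 of the
   coordinates of a representative, stacked as the rows of a matrix. *)
Definition jet_chart (phi : chart R M (mdim M)) :
    chart R jet (k.+1 * mdim M) :=
  Chart
    [set X | source phi (jet_rep X 0)]
    [set z | target phi (row ord0 (vec_mx z))]
    (fun X => mxvec (\matrix_(i < k.+1) derive1n i (chart_map phi \o jet_rep X) 0))
    (fun z => jet_of (fun t =>
       param phi (\sum_(i < k.+1) (t ^+ i / i`!%:R) *: row i (vec_mx z)))).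

Definition jet_manifold : manifold R :=
  Manifold [set jet_chart phi | phi in @atlas R M].

End JetManifold.

Definition jet_group (G : lieGroup R) : lieGroup R :=
  @LieGroup R (jet_manifold G)
    (jet_of (fun=> lone G))
    (fun X => jet_of (fun t => linv (jet_rep X t)))
    (fun X Y => jet_of (fun t => lmul (jet_rep X t) (jet_rep Y t))).

End Jets.

Section TangentGroup.
Context {R : realType}.
Variable G : lieGroup R.

(* The tangent bundle is the space of 1-jets of curves, and the tangent functor
   sends the class of [c] to the class of [f \o c]: the tangent group of [H] is
   [jet_group 1 H]. *)
Fixpoint tangent_group (k : nat) : lieGroup R :=
  if k is j.+1 then jet_group 1 (tangent_group j) else G.

(* Tangent vectors at the unit are recorded by their coordinates in all the
   charts around it; the elements of the Lie algebra are the families related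
   by the differentials of the transition maps. *)
Definition lie_algebra : Type :=
  {phi | charts_at (lone G) phi} -> 'rV[R]_(mdim G).

Definition velocity (c : R -> G) : lie_algebra :=
  fun phi => derive1 (chart_map (sval phi) \o c) 0.

Definition derive_lie_algebra (u : R -> lie_algebra) : lie_algebra :=
  fun phi => derive1 (fun t => u t phi) 0.

(* [(g, x)] stands for the family of [g] and of the [x A], for [A] a nonempty
   subset of [{0, ..., k-1}]; by convention [x set0 = 0]. *)
Definition trivialized (k : nat) : Type :=
  (G * ({set 'I_k} -> lie_algebra))%type.

(* The right trivialization sends the class of a curve [c] in [T^j G] to [c 0],
   trivialized in turn, and to the vector represented by
   [d t = c t * (c 0)^-1] in the Lie algebra of [T^j G]. The components of
   index not containing [ord_max] are those of [c 0]; the others are the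
   derivatives at 0 of the components of [d] in the trivialization of
   [T^j G]. *)
Fixpoint right_triv (k : nat) : tangent_group k -> trivialized k :=
  match k return tangent_group k -> trivialized k with
  | 0 => fun g => (g, fun _ _ => 0)
  | j.+1 => fun X =>
      let c : R -> tangent_group j := jet_rep X in
      let d t := right_triv (lmul (c t) (linv (c 0))) in
      let v0 := right_triv (c 0) in
      (v0.1, fun A : {set 'I_j.+1} =>
         let B : {set 'I_j} := [set i | lift ord_max i \in A]%SET in
         if ord_max \notin A then v0.2 B
         else if B == finset.set0 then velocity (fun t => (d t).1)
         else derive_lie_algebra (fun t => (d t).2 B))
  end.

(* The component of index [s @: A] of [sym_act s (g, x)] is [x A]. *)
Definition sym_act (k : nat) (s : {perm 'I_k}) (v : trivialized k) :
    trivialized k :=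
  (v.1, fun A : {set 'I_k} => v.2 (s @^-1: A)%SET).

Definition sym_fixed (k : nat) : set (tangent_group k) :=
  [set v | forall s : {perm 'I_k}, sym_act s (right_triv v) = right_triv v].

End TangentGroup.

Arguments sym_fixed {R} G k _.

(* Main.v *)
From HB Require Import structures.
Require Import Defs.
From mathcomp Require Import all_boot all_order all_algebra all_fingroup.
From mathcomp Require Import all_classical all_reals all_analysis.
Import Order.TTheory GRing.Theory Num.Theory numFieldNormedType.Exports.

Set Implicit Arguments.
Unset Strict Implicit.
Unset Printing Implicit Defensive.

Local Open Scope classical_set_scope.
Local Open Scope ring_scope.

(* Send the k-jet of a curve c to the class in T^k G of the k-parameter family
   c(t_1 + ... + t_k). This map is multiplicative, and in charts it is an
   injective linear map of the derivatives of c, hence an embedding. Writing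
   xi = c' c^-1, its component of index A in the right trivialization is
   xi^(|A|-1)(0), because c(s + t) = (c(s + t) c(s)^-1) c(s); it depends only on
   |A|, so the image is fixed by S_k. Conversely, let v be fixed. By induction
   the base point of v in T^(k-1) G comes from a curve c. By symmetry every
   component of v is determined by this base point, except the one of index
   {1, ..., k}, which can be adjusted by multiplying c on the left by a curve
   that equals the unit up to order k - 1; and the right trivialization is
   injective. *)

(** * Smooth maps *)

(** The bridge between the trivialization and the charts is [derive1_triv_coord]: along a curve that
    passes through the unit, a component of the right trivialization and the matching mixed partial
    derivative in a chart have the same derivative. Each step of the trivialization first translates
    to the unit, so this comparison gives both its injectivity and the control of the top component.

    On the chart side everything stays of first order. Chart independence of [k]-jets would call for
    a higher-order chain rule; but [T^k G] is an iteration of 1-jets, where the ordinary chain rule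
    suffices, and the facts needed about [J^k G] are pulled back along the embedding. This is
    possible because the embedding has a linear retraction in charts. The same retraction yields the
    transition maps of [J^k G] and the smooth local extensions of the inverse isomorphism.

    The [k]-parameter family is handled as iterated curves of translates of [c]. Smoothness and
    chart formulas are therefore needed at all small times and not only at [0], which explains the
    many statements valid near a point. *)

Section BilinearScale.
Context {R : realType} {W : normedModType R}.

(** Registering scaling as a bilinear map makes the product rule an instance of [diff_bilin]. *)
Lemma scale_is_bilinear : bilinear_for
  (GRing.Scale.Law.clone _ _ ( *:%R ) _) (GRing.Scale.Law.clone _ _ ( *:%R ) _)
  (@GRing.scale R W : R -> W -> W).
Proof.
split=> [u'|u] a x y /=; first by rewrite scalerDl scalerA.
by rewrite scalerDr !scalerA mulrC.
Qed.

HB.instance Definition _ := bilinear_isBilinear.Build R R W W _ _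
  (@GRing.scale R W) scale_is_bilinear.

Lemma differentiable_scale (V : normedModType R) (a : V -> R) (f : V -> W) x :
  differentiable a x -> differentiable f x ->
  differentiable (fun y => a y *: f y) x.
Proof.
move=> da df; have cs : continuous (fun p : R * W => p.1 *: p.2).
  exact: scale_continuous.
apply: (@differentiable_comp _ _ _ _ (fun y => (a y, f y))
  (fun p : R * W => p.1 *: p.2)); first exact: differentiable_pair.
exact: (@differentiable_bilin _ _ _ _ (@GRing.scale R W)).
Qed.

Lemma derive_scale (V : normedModType R) (a : V -> R) (f : V -> W) x v :
  differentiable a x -> differentiable f x ->
  'D_v (fun y => a y *: f y) x = a x *: 'D_v f x + 'D_v a x *: f x.
Proof.
move=> da df; have cs : continuous (fun p : R * W => p.1 *: p.2).
  exact: scale_continuous.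
rewrite deriveE; last exact: differentiable_scale.
rewrite -[X in 'd X _]/((fun p : R * W => p.1 *: p.2) \o (fun y => (a y, f y))).
rewrite diff_comp; last 2 first.
- exact: differentiable_pair.
- exact: (@differentiable_bilin _ _ _ _ (@GRing.scale R W)).
rewrite (@diff_bilin _ _ _ _ (@GRing.scale R W)) //= diff_pair //=.
by rewrite !deriveE.
Qed.

End BilinearScale.

Section Differentials.
Context {R : realType} {V W : normedModType R}.

Lemma near_eq_differentiable (f g : V -> W) x :
  {near x, f =1 g} -> differentiable f x -> differentiable g x.
Proof.
move=> fg df; have [dc /eqaddoP ef] := (diff_locallyP _ _).1 df.
have fgx := nbhs_singleton fg.
have eg : g \o shift x = cst (g x) + 'd f x +o_ 0 id.
  apply/eqaddoP => e e0.
  have nh : \forall h \near (0 : V), f (h + x) = g (h + x).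
    by have := fg; rewrite {1}(near_shift 0 x) /= subr0.
  apply: filterS2 nh (ef e e0) => h fgh.
  by rewrite -[(f \o shift x - _) h]/(f (h + x) - (f x + 'd f x h)) fgh fgx.
(* The expansion [eg] of [g] has the differential of [f] as linear part, so uniqueness identifies
   the two differentials. *)
have E : 'd g x = 'd f x :> (V -> W) by apply: diff_unique.
by apply/diff_locallyP; rewrite E.
Qed.

End Differentials.

(** Finite dimension in the form that the chain rule uses: a direction that varies with the point is
    expanded over fixed directions with continuous linear coefficients. As a class, it is inferred
    for the scalars, matrices and products in which charts live. *)
Class framed {R : realType} (W : normedModType R) : Prop :=
  framedP : exists (I : finType) (e : I -> W) (l : I -> {linear W -> R}),
    (forall i, continuous (l i)) /\ forall w, w = \sum_i l i w *: e i.

Section Calculus.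
Context {R : realType}.
Implicit Types V W X : normedModType R.

(* Order [0] already asks for differentiability, hence [f] is of class C^n on
   [U] and its derivatives of order [n] are differentiable there. *)
Fixpoint Cn V W (n : nat) (U : set V) (f : V -> W) : Prop :=
  (forall y, U y -> differentiable f y) /\
  (if n is m.+1 then forall v, Cn m U (fun y => 'D_v f y) else True).

Lemma Cn_diff V W n (U : set V) (f : V -> W) y :
  Cn n U f -> U y -> differentiable f y.
Proof. by case: n => [|n] [h _]; apply: h. Qed.

Lemma CnW V W n (U : set V) (f : V -> W) : Cn n.+1 U f -> Cn n U f.
Proof.
elim: n f => [|n IHn] f [df Df]; split=> // v; apply: IHn; exact: Df.
Qed.

Lemma Cn_eq V W n (U : set V) (f g : V -> W) : open U ->
  (forall y, U y -> f y = g y) -> Cn n U f -> Cn n U g.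
Proof.
move=> oU fg.
have near_fg f' g' y : (forall y, U y -> f' y = g' y :> W) -> U y ->
    {near y, f' =1 g'}.
  by move=> fg' Uy; apply: filterS (open_nbhs_nbhs (conj oU Uy)).
elim: n f g fg => [|n IHn] f g fg [df Df]; split=> //; last first.
- move=> v; apply: (IHn _ _ _ (Df v)) => y Uy; apply: near_eq_derive.
  exact: near_fg.
- by move=> y Uy; apply: near_eq_differentiable (df y Uy); exact: near_fg.
- by move=> y Uy; apply: near_eq_differentiable (df y Uy); exact: near_fg.
Qed.

Lemma Cn_cst V W n (U : set V) (a : W) : Cn n U (cst a).
Proof.
elim: n a => [|n IHn] a; split=> //; try by move=> y _;
  exact: differentiable_cst.
move=> v; rewrite (_ : (fun y => _) = cst 0); first exact: IHn.
by apply/funext => y; rewrite derive_cst.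
Qed.

Lemma Cn_linear V W n (U : set V) (f : {linear V ->
  W}) : continuous f -> Cn n U f.
Proof.
move=> fc; have df y : differentiable f y by exact: linear_differentiable.
case: n => [|n]; split=> // v.
rewrite (_ : (fun y => _) = cst (f v)); first exact: Cn_cst.
by apply/funext => y; rewrite deriveE // diff_lin.
Qed.

Lemma CnD V W n (U : set V) (f g : V -> W) : open U ->
  Cn n U f -> Cn n U g -> Cn n U (fun y => f y + g y).
Proof.
move=> oU; elim: n f g => [|n IHn] f g hf hg; split=> //.
- by move=> y Uy; apply: differentiableD;
  [apply: Cn_diff hf _ |apply: Cn_diff hg _].
- by move=> y Uy; apply: differentiableD;
  [apply: Cn_diff hf _ |apply: Cn_diff hg _].
move=> v; have [_ /(_ v) hf'] := hf; have [_ /(_ v) hg'] := hg.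
apply: Cn_eq (IHn _ _ hf' hg') => // y Uy.
by rewrite -deriveD //; apply: diff_derivable;
  [apply: Cn_diff hf _ |apply: Cn_diff hg _].
Qed.

Lemma Cn_sum V W (I : Type) (s : seq I) n (U : set V) (f : I
  -> V -> W) : open U ->
  (forall i, Cn n U (f i)) -> Cn n U (fun y => \sum_(i <- s) f i y).
Proof.
move=> oU hf; elim: s => [|i s IHs].
  rewrite (_ : (fun y => _) = cst 0); first exact: Cn_cst.
  by apply/funext => y; rewrite big_nil.
apply: Cn_eq (CnD oU (hf i) IHs) => // y _.
by rewrite big_cons.
Qed.

Lemma Cn_scale V W n (U : set V) (a : V -> R) (f : V -> W) : open U ->
  Cn n U a -> Cn n U f -> Cn n U (fun y => a y *: f y).
Proof.
move=> oU; elim: n a f => [|n IHn] a f ha hf; split=> //.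
- by move=> y Uy; apply: differentiable_scale;
  [apply: Cn_diff ha _ |apply: Cn_diff hf _].
- by move=> y Uy; apply: differentiable_scale;
  [apply: Cn_diff ha _ |apply: Cn_diff hf _].
move=> v; have [_ /(_ v) ha'] := ha; have [_ /(_ v) hf'] := hf.
apply: Cn_eq (CnD oU (IHn _ _ (CnW ha) hf') (IHn _ _ ha' (CnW hf))) => // y Uy.
by rewrite -derive_scale //; [apply: Cn_diff ha _ |apply: Cn_diff hf _].
Qed.

Lemma Cn_linear_comp V W X n (U : set V) (f : V -> W) (l : {linear W -> X}) :
  open U -> continuous l -> Cn n U f -> Cn n U (l \o f).
Proof.
move=> oU lc; have dl y : differentiable l y by exact: linear_differentiable.
elim: n f => [|n IHn] f hf; split=> //.
- by move=> y Uy; apply: differentiable_comp => //; apply: Cn_diff hf _.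
- by move=> y Uy; apply: differentiable_comp => //; apply: Cn_diff hf _.
move=> v; have [df /(_ v) hf'] := hf.
apply: Cn_eq (IHn _ hf') => // y Uy; have dfy := df _ Uy.
rewrite (deriveE _ (differentiable_comp dfy (dl (f y))))
  diff_comp // diff_lin //.
by rewrite /= deriveE.
Qed.

Lemma Cn_pair V W X n (U : set V) (f : V -> W) (g : V -> X) : open U ->
  Cn n U f -> Cn n U g -> Cn n U (fun y => (f y, g y)).
Proof.
move=> oU; elim: n f g => [|n IHn] f g hf hg; split=> //.
- by move=> y Uy; apply: differentiable_pair;
  [apply: Cn_diff hf _ |apply: Cn_diff hg _].
- by move=> y Uy; apply: differentiable_pair;
  [apply: Cn_diff hf _ |apply: Cn_diff hg _].
move=> v; have [df /(_ v) hf'] := hf; have [dg /(_ v) hg'] := hg.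
apply: Cn_eq (IHn _ _ hf' hg') => // y Uy.
rewrite !deriveE ?diff_pair //; try exact: df; try exact: dg.
by apply: differentiable_pair; [exact: df|exact: dg].
Qed.

(* The direction ['D_v f y] varies with [y]; decomposing it along a finite frame
   expresses ['D_v (g \o f)] through the ['D_(e i) g], to which the induction
   hypothesis applies. *)
Lemma Cn_comp V W X {fW : framed W} n (U : set V) (U' : set W)
    (f : V -> W) (g : W -> X) : open U -> (forall y, U y -> U' (f y)) ->
  Cn n U f -> Cn n U' g -> Cn n U (g \o f).
Proof.
have [I [e [l [lc le]]]] := fW.
move=> oU fU; elim: n g => [|n IHn] g hf hg; split=> //.
- move=> y Uy; apply: differentiable_comp; first exact: Cn_diff hf _.
  by apply: Cn_diff hg _; exact: fU.
- move=> y Uy; apply: differentiable_comp; first exact: Cn_diff hf _.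
  by apply: Cn_diff hg _; exact: fU.
move=> v; have [df /(_ v) hf'] := hf; have [dg hg'] := hg.
have H : Cn n U (fun y => \sum_(i <- index_enum I)
    (l i \o (fun y => 'D_v f y)) y *: ((fun w => 'D_(e i) g w) \o f) y).
  apply: Cn_sum => // i; apply: Cn_scale => //; first exact: Cn_linear_comp.
  by apply: IHn; [exact: CnW|exact: hg'].
apply: Cn_eq H => // y Uy; have dfy := df _ Uy; have dgy := dg _ (fU _ Uy).
transitivity ('d g (f y) ('D_v f y)); last first.
  by rewrite (deriveE _ (differentiable_comp dfy dgy))
    (diff_comp dfy dgy) deriveE.
rewrite [in RHS](le ('D_v f y)) linear_sum.
by apply: eq_bigr => i _; rewrite linearZ /= -deriveE.
Qed.

End Calculus.

Section Frames.
Context {R : realType}.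

(** Through a frame, a linear map is a finite combination of continuous functionals. *)
Lemma framed_linear_continuous (V W : normedModType R) {fV : framed V}
  (f : {linear V -> W}) : continuous f.
Proof.
have [I [e [l [lc le]]]] := fV.
have -> : (f : V -> W) = fun v => \sum_i l i v *: f (e i).
  by apply/funext => v; rewrite {1}(le v) linear_sum; apply: eq_bigr => i _;
    rewrite linearZ.
move=> v; elim: index_enum => [|i s IHs].
  by rewrite (_ : (fun v => _) = cst 0);
    [exact: cst_continuous|apply/funext => y; rewrite big_nil].
rewrite (_ : (fun v => _) = fun v =>
  l i v *: f (e i) + \sum_(j <- s) l j v *: f (e j)).
  by apply: cvgD; [apply: cvgZr_tmp; exact: lc|exact: IHs].
by apply/funext => y; rewrite big_cons.
Qed.

Global Instance framed_R : framed R.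
Proof.
exists unit, (fun _ => 1), (fun _ => idfun); split => [_ x //|w].
by rewrite (big_pred1 tt) ?[_ *: _]mulr1 //; case.
Qed.

Global Instance framed_mx m n : framed 'M[R]_(m, n).
Proof.
exists ('I_m * 'I_n)%type, (fun ij => delta_mx ij.1 ij.2).
have lin (ij : 'I_m * 'I_n) : linear (fun A : 'M[R]_(m, n) => A ij.1 ij.2).
  by move=> a A B; rewrite !mxE.
pose L ij : {linear 'M[R]_(m, n) -> R} :=
  HB.pack (fun A : 'M[R]_(m, n) =>
    A ij.1 ij.2) (GRing.isLinear.Build _ _ _ _ _ (lin ij)).
exists L; split.
  by move=> ij; exact: coord_continuous.
by move=> A; rewrite {1}(matrix_sum_delta A) pair_bigA.
Qed.

Global Instance framed_prod (V W : normedModType R) {fV : framed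
  V} {fW : framed W} :
  framed (V * W)%type.
Proof.
have [I [e [l [lc le]]]] := fV; have [J [d [m [mc me]]]] := fW.
exists (I + J)%type, (fun k => match k with inl i =>
  (e i, 0) | inr j => (0, d j) end).
have linl i : linear (fun p : V * W =>
  l i p.1) by move=> a p q; rewrite linearP.
have linr j : linear (fun p : V * W =>
  m j p.2) by move=> a p q; rewrite linearP.
pose L1 i : {linear (V * W)%type -> R} :=
  HB.pack (fun p : V * W => l i p.1) (GRing.isLinear.Build _ _ _ _ _ (linl i)).
pose L2 j : {linear (V * W)%type -> R} :=
  HB.pack (fun p : V * W => m j p.2) (GRing.isLinear.Build _ _ _ _ _ (linr j)).
exists (fun k => match k with inl i => L1 i | inr j => L2 j end); split.
  case=> [i|j] p /=.
    by apply: continuous_comp; [exact: cvg_fst|exact: lc].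
  by apply: continuous_comp; [exact: cvg_snd|exact: mc].
case=> v w; rewrite big_sumType /= {1}(le v) {1}(me w).
have E1 : \sum_i l i v *: (e i, 0 : W) = (\sum_i l i v *: e i, 0).
  have: forall s : seq I, \sum_(i <- s) l i v *: (e i, 0 : W) =
     (\sum_(i <- s) l i v *: e i, 0).
    elim=> [|i s IHs]; first by rewrite !big_nil.
    by rewrite !big_cons IHs; congr (_, _); rewrite /= scaler0 addr0.
  by apply.
have E2 : \sum_j m j w *: (0 : V, d j) = (0, \sum_j m j w *: d j).
  have: forall s : seq J, \sum_(j <- s) m j w *: (0 : V, d j) =
     (0, \sum_(j <- s) m j w *: d j).
    elim=> [|j s IHs]; first by rewrite !big_nil.
    by rewrite !big_cons IHs; congr (_, _); rewrite /= scaler0 addr0.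
  by apply.
by rewrite E1 E2; congr (_, _); rewrite /= ?addr0 ?add0r.
Qed.

End Frames.

Section SmoothTheory.
Context {R : realType}.
Implicit Types V W X : normedModType R.

Lemma iter_derive_rcons V W (vs : seq V) v (f : V -> W) :
  iter_derive (rcons vs v) f = iter_derive vs (fun x => 'D_v f x).
Proof. by rewrite /iter_derive foldr_rcons. Qed.

(** Trades lists of directions for an induction on the order: closure properties are proved for [Cn]
    one order at a time, on an open set that serves all orders. *)
Lemma smoothP V W (f : V -> W) x :
  smooth f x <-> exists U, [/\ open U, U x & forall n, Cn n U f].
Proof.
split=> [|[U [oU Ux hf]]]; last first.
  apply: filterS (open_nbhs_nbhs (conj oU Ux)) => y Uy vs.
  (* The last direction of [vs] is the innermost derivative, so the list is peeled from its end, in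
     step with the recursion of [Cn]. *)
  elim/last_ind: vs f hf => [|vs v IHvs] f hf; first exact: Cn_diff (hf 0%N) Uy.
  rewrite iter_derive_rcons; apply: IHvs => n.
  by have [_] := hf n.+1; apply.
rewrite /smooth /prop_near1 nbhsE => -[U [oU Ux] UP]; exists U; split=> // n.
have {UP} : forall y, U y -> forall vs,
  differentiable (iter_derive vs f) y by exact: UP.
elim: n f => [|n IHn] f hf; split=> //.
- by move=> y Uy; exact: (hf y Uy [::]).
- by move=> y Uy; exact: (hf y Uy [::]).
move=> v; apply: IHn => y Uy vs; rewrite -iter_derive_rcons; exact: hf.
Qed.

Lemma smooth_near V W (f : V -> W) x : smooth f x ->
  \forall y \near x, smooth f y.
Proof. exact: near_join. Qed.

Lemma smooth_eq V W (f g : V -> W) x :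
  {near x, f =1 g} -> smooth f x -> smooth g x.
Proof.
rewrite /prop_near1 nbhsE => -[U [oU Ux] UP] /smoothP[U' [oU' U'x hf]].
apply/smoothP; exists (U `&` U'); split=> [|//|n]; first exact: openI.
have {}hf : Cn n (U `&` U') f.
  elim: n f {UP} hf => [|n IHn] f hf; split=> //.
  - by move=> y [_ U'y]; exact: Cn_diff (hf 0%N) U'y.
  - by move=> y [_ U'y]; exact: Cn_diff (hf 0%N) U'y.
  by move=> v; apply: IHn => m; have [_] := hf m.+1; apply.
apply: Cn_eq hf; first exact: openI.
by move=> y [Uy _]; exact: UP.
Qed.

Lemma CnS V W n (U U' : set V) (f : V -> W) : U `<=` U' ->
  Cn n U' f -> Cn n U f.
Proof.
move=> UU'; elim: n f => [|n IHn] f [df Df]; split=> //;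
  try by move=> y /UU' /df.
by move=> v; apply: IHn; exact: Df.
Qed.

Lemma smooth_diff V W (f : V -> W) x : smooth f x -> differentiable f x.
Proof. by move=> /nbhs_singleton /(_ [::]). Qed.

Lemma smooth_continuous V W (f : V -> W) x : smooth f x ->
  {for x, continuous f}.
Proof. by move=> /smooth_diff; exact: differentiable_continuous. Qed.

Lemma smooth_derive V W (f : V -> W) v x : smooth f x ->
  smooth (fun y => 'D_v f y) x.
Proof.
by apply: filterS => y hy vs; rewrite -iter_derive_rcons; exact: hy.
Qed.

Lemma smooth2 V W1 W2 W3 (f : V -> W1) (g : V -> W2) (h : V -> W3) x :
  (forall n U, open U -> Cn n U f -> Cn n U g -> Cn n U h) ->
  smooth f x -> smooth g x -> smooth h x.
Proof.
move=> H /smoothP[U [oU Ux hf]] /smoothP[U' [oU' U'x hg]].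
apply/smoothP; exists (U `&` U'); split=> [|//|n]; first exact: openI.
apply: H; first exact: openI.
  by apply: CnS (hf n) => y [].
by apply: CnS (hg n) => y [].
Qed.

Lemma smoothD V W (f g : V -> W) x :
  smooth f x -> smooth g x -> smooth (fun y => f y + g y) x.
Proof. by apply: smooth2 => n U; exact: CnD. Qed.

Lemma smooth_scale V W (a : V -> R) (f : V -> W) x :
  smooth a x -> smooth f x -> smooth (fun y => a y *: f y) x.
Proof. by apply: smooth2 => n U; exact: Cn_scale. Qed.

Lemma smooth_pair V W X (f : V -> W) (g : V -> X) x :
  smooth f x -> smooth g x -> smooth (fun y => (f y, g y)) x.
Proof. by apply: smooth2 => n U; exact: Cn_pair. Qed.

Lemma smooth_sum V W (I : Type) (s : seq I) (f : I -> V -> W) x :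
  (forall i, smooth (f i) x) -> smooth (fun y => \sum_(i <- s) f i y) x.
Proof.
move=> hf; elim: s => [|i s IHs].
  rewrite (_ : (fun y => _) = cst 0); first exact: smooth_cst.
  by apply/funext => y; rewrite big_nil.
rewrite (_ : (fun y => _) = (fun y => f i y + \sum_(j <- s) f j y)).
  exact: smoothD.
by apply/funext => y; rewrite big_cons.
Qed.

Lemma smooth_linear V W {fV : framed V} (f : {linear V -> W}) x : smooth f x.
Proof.
apply/smoothP; exists setT; split=> // [|n]; first exact: openT.
by apply: Cn_linear; exact: framed_linear_continuous.
Qed.

Lemma smooth_comp V W X {fW : framed W} (f : V -> W) (g : W -> X) x :
  smooth f x -> smooth g (f x) -> smooth (g \o f) x.
Proof.
move=> sf; have fc := smooth_continuous sf.
move: sf => /smoothP[U [oU Ux hf]] /smoothP[U' [oU' U'fx hg]].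
have /fc : nbhs (f x) U' by exact: (open_nbhs_nbhs (conj oU' U'fx)).
rewrite /= nbhsE => -[U1 [oU1 U1x] U1U'].
apply/smoothP; exists (U `&` U1); split=> [|//|n]; first exact: openI.
apply: (Cn_comp (U' := U')) (hg n); first exact: openI.
  by move=> y [_ /U1U'].
by apply: CnS (hf n) => y [].
Qed.

Lemma smooth_mx V m n (M : V -> 'M[R]_(m, n)) x :
  (forall i j, smooth (fun y => M y i j) x) -> smooth M x.
Proof.
move=> hM; have -> : M = fun y => \sum_i \sum_j M y i j *: delta_mx i j.
  by apply/funext => y; exact: matrix_sum_delta.
do 2 (apply: smooth_sum => ?); apply: smooth_scale; first exact: hM.
exact: smooth_cst.
Qed.

Lemma smooth_fst V W {fV : framed V} {fW : framed W} (p : V * W) :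
  smooth (fun q : V * W => q.1) p.
Proof.
have lin : linear (fun q : V * W => q.1) by [].
pose L : {linear (V * W)%type -> V} :=
  HB.pack (fun q : V * W => q.1) (GRing.isLinear.Build _ _ _ _ _ lin).
exact: (smooth_linear L).
Qed.

Lemma smooth_snd V W {fV : framed V} {fW : framed W} (p : V * W) :
  smooth (fun q : V * W => q.2) p.
Proof.
have lin : linear (fun q : V * W => q.2) by [].
pose L : {linear (V * W)%type -> W} :=
  HB.pack (fun q : V * W => q.2) (GRing.isLinear.Build _ _ _ _ _ lin).
exact: (smooth_linear L).
Qed.

(** Joint smoothness of the tangent map in point and direction. Expanding the direction over a frame
    leaves derivatives along fixed vectors, smooth in the point, with coefficients linear in the
    direction. *)
Lemma smooth_tangent V W {fV : framed V} (f : V -> W) (x y : V) :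
  smooth f x -> smooth (fun p : V * V => 'D_(p.2) f p.1) (x, y).
Proof.
move=> sf; have [I [e [l [lc le]]]] := fV.
have s1 : smooth (fun q : V * V => q.1) (x, y) by exact: smooth_fst.
have s2 : smooth (fun q : V * V => q.2) (x, y) by exact: smooth_snd.
have H : smooth (fun p : V * V =>
    \sum_(i <- index_enum I) l i p.2 *: 'D_(e i) f p.1) (x, y).
  apply: smooth_sum => i; apply: smooth_scale.
    by apply: (smooth_comp (g := l i) s2); exact: smooth_linear.
  by apply: (smooth_comp (g := fun y => 'D_(e i) f y) s1); exact: smooth_derive.
apply: smooth_eq H.
have : \forall p \near (x, y), differentiable f p.1.
  have /cvg_fst : nbhs x [set z | differentiable f z].
    by apply: filterS sf => z /(_ [::]).
  by apply.
apply: filterS => p dp /=; rewrite deriveE // [in RHS](le p.2) linear_sum.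
by apply: eq_bigr => i _; rewrite linearZ /= deriveE.
Qed.

End SmoothTheory.

(** * Manifolds without topological axioms *)

Section PreManifold.
Context {R : realType}.
Implicit Types M N : manifold R.
Implicit Types V W : normedModType R.

(* The manifold axioms except the two topological ones, which play no role in
   what follows and need not be checked on jet spaces. *)
Record premanifold M : Prop := Premanifold {
  pm_cover : forall p : M, exists phi, charts_at p phi;
  pm_open_target : forall phi, atlas (m := M) phi -> open (target phi);
  pm_coord : forall phi, atlas (m := M) phi -> forall p, source phi p ->
    target phi (chart_map phi p) /\ param phi (chart_map phi p) = p;
  pm_param : forall phi, atlas (m := M) phi -> forall x, target phi x ->
    source phi (param phi x) /\ chart_map phi (param phi x) = x;
  pm_transition : forall (p : M) phi, charts_at p phi ->
    smooth_into (param phi) (chart_map phi p) }.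

Lemma manifold_pre M : is_manifold M -> premanifold M.
Proof. by case. Qed.

Section Fixed.
Variable M : manifold R.
Hypothesis pM : premanifold M.

Lemma chart_paramK (p : M) phi : charts_at p phi ->
  param phi (chart_map phi p) = p.
Proof. by move=> [aphi /(pm_coord pM aphi)[]]. Qed.

Lemma chart_target (p : M) phi : charts_at p phi ->
  target phi (chart_map phi p).
Proof. by move=> [aphi /(pm_coord pM aphi)[]]. Qed.

Lemma chart_inj (p q : M) phi : charts_at p phi -> charts_at q phi ->
  chart_map phi p = chart_map phi q -> p = q.
Proof. by move=> cp cq E; rewrite -(chart_paramK cp) E chart_paramK. Qed.

Lemma near_target (p : M) phi : charts_at p phi ->
  \forall x \near chart_map phi p, target phi x.
Proof.
move=> cp; apply: open_nbhs_nbhs; split; last exact: chart_target.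
by apply: pm_open_target => //; case: cp.
Qed.

Lemma smooth_into_eq V (f g : V -> M) x :
  {near x, f =1 g} -> smooth_into f x -> smooth_into g x.
Proof.
move=> fg sf phi; rewrite -(nbhs_singleton fg) => /sf[src sm]; split.
  by apply: filterS2 fg src => y <-.
by apply: smooth_eq sm; apply: filterS fg => y /= ->.
Qed.

(** One chart is enough, because the transition maps carry smoothness to all the others. *)
Lemma smooth_into_chart V (f : V -> M) x phi : charts_at (f x) phi ->
  (\forall y \near x, source phi (f y)) -> smooth (chart_map phi \o f) x ->
  smooth_into f x.
Proof.
move=> cphi src sm psi cpsi.
have /(_ psi)[|tsrc tsm] := pm_transition pM cphi;
  first by rewrite chart_paramK.
have fc := smooth_continuous sm.
have fP : {near x, param phi \o (chart_map phi \o f) =1 f}.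
  apply: filterS src => y sy /=; apply: chart_paramK; split=> //.
  by case: cphi.
split.
  by have := fc _ tsrc; apply: filterS2 fP => y /= ->.
apply: smooth_eq (smooth_comp sm tsm).
by apply: filterS fP => y /= ->.
Qed.

(** Keeps the translates of a smooth curve smooth at small times, as the iterated tangent
    construction requires. *)
Lemma smooth_into_near V (f : V -> M) x :
  smooth_into f x -> \forall y \near x, smooth_into f y.
Proof.
move=> sf; have [phi cphi] := pm_cover pM (f x).
have [src sm] := sf _ cphi.
apply: filterS2 (near_join src) (smooth_near sm) => y sy smy.
apply: smooth_into_chart smy => //; split; first by case: cphi.
exact: nbhs_singleton sy.
Qed.

Lemma smooth_into_comp V W {fW : framed W} (h : V -> W) (f : W -> M) x :
  smooth h x -> smooth_into f (h x) -> smooth_into (f \o h) x.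
Proof.
move=> sh sf phi /sf[src sm]; split.
  exact: (smooth_continuous sh src).
exact: smooth_comp sh sm.
Qed.

Lemma mopen_source phi : atlas (m := M) phi -> mopen (source phi).
Proof.
move=> aphi psi apsi; rewrite openE => y [ty sy].
have [spy Ey] := pm_param pM apsi ty.
have /(_ phi)[|] := pm_transition pM (conj apsi spy); first by rewrite Ey.
rewrite Ey => src _; apply: filterI src.
by apply: open_nbhs_nbhs; split=> //; exact: pm_open_target.
Qed.

End Fixed.

Lemma msmooth_into M N V (F : M -> N) (f : V -> M) x : premanifold M ->
  msmooth F (f x) -> smooth_into f x -> smooth_into (F \o f) x.
Proof.
move=> pM sF sf; have [phi cphi] := pm_cover pM (f x).
have [src sm] := sf _ cphi.
apply: smooth_into_eq (smooth_into_comp sm (sF _ cphi)).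
apply: filterS src => y sy /=; congr F; apply: (chart_paramK pM); split=> //.
by case: cphi.
Qed.

End PreManifold.

Section PreLie.
Context {R : realType}.
Implicit Types G : lieGroup R.
Implicit Types V W : normedModType R.

Record prelie G : Prop := Prelie {
  pl_premanifold : premanifold G;
  pl_mulA : associative (@lmul R G);
  pl_mul1 : left_id (lone G) (@lmul R G);
  pl_mulV : left_inverse (lone G) (@linv R G) (@lmul R G);
  pl_smooth_mul : forall (p q : G) phi psi, charts_at p phi ->
    charts_at q psi ->
    smooth_into (fun z : 'rV[R]_(mdim G) * 'rV[R]_(mdim G) =>
                   lmul (param phi z.1) (param psi z.2))
                (chart_map phi p, chart_map psi q);
  pl_smooth_inv : forall p : G, msmooth (@linv R G) p }.

Lemma lie_pre G : is_lie_group G -> prelie G.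
Proof. by case=> /manifold_pre *; split. Qed.

Section Fixed.
Variable G : lieGroup R.
Hypothesis pG : prelie G.
Let pM := pl_premanifold pG.

Lemma lmulV (p : G) : lmul p (linv p) = lone G.
Proof.
have mA := pl_mulA pG; have m1 := pl_mul1 pG; have mV := pl_mulV pG.
by rewrite -[lmul p _]m1 -{1}(mV (linv p)) -mA (mA (linv p) p) mV m1 mV.
Qed.

Lemma lmul1 (p : G) : lmul p (lone G) = p.
Proof. by rewrite -(pl_mulV pG p) (pl_mulA pG) lmulV (pl_mul1 pG). Qed.

Lemma lmulVK (p q : G) : lmul (lmul p (linv q)) q = p.
Proof. by rewrite -(pl_mulA pG) (pl_mulV pG) lmul1. Qed.

Lemma lmulK (p q : G) : lmul (lmul p q) (linv q) = p.
Proof. by rewrite -(pl_mulA pG) lmulV lmul1. Qed.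

Lemma linv_uniq (p q : G) : lmul p q = lone G -> p = linv q.
Proof. by move=> E; rewrite -(lmulK p q) E (pl_mul1 pG). Qed.

Lemma smooth_into_mul V (f g : V -> G) x : smooth_into f x ->
  smooth_into g x -> smooth_into (fun y => lmul (f y) (g y)) x.
Proof.
move=> sf sg; have [phi cphi] := pm_cover pM (f x).
have [psi cpsi] := pm_cover pM (g x).
have [srcf smf] := sf _ cphi; have [srcg smg] := sg _ cpsi.
apply: smooth_into_eq (smooth_into_comp (smooth_pair smf smg)
  (pl_smooth_mul pG cphi cpsi)).
apply: filterS2 srcf srcg => y sf1 sg1 /=; congr lmul.
  by apply: (chart_paramK pM); split=> //; case: cphi.
by apply: (chart_paramK pM); split=> //; case: cpsi.
Qed.

Lemma smooth_into_inv V (f : V -> G) x : smooth_into f x ->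
  smooth_into (fun y => linv (f y)) x.
Proof.
move=> sf.
exact: (@msmooth_into _ _ _ _ (@linv R G) f x pM
  (@pl_smooth_inv _ pG (f x)) sf).
Qed.

End Fixed.
End PreLie.

(** * Jets of curves *)

Section CurveCalculus.
Context {R : realType}.
Implicit Types V W : normedModType R.

Lemma smooth_id V (x : V) : smooth (fun y : V => y) x.
Proof.
apply/smoothP; exists setT; split=> // [|n]; first exact: openT.
by apply: (@Cn_linear _ _ _ _ _ idfun) => y; exact: cvg_id.
Qed.

Lemma smooth_shift V (t x : V) : smooth (fun y => t + y) x.
Proof. by apply: smoothD; [exact: smooth_cst|exact: smooth_id]. Qed.

Lemma near_eq_derive1 V (f g : R -> V) t :
  {near t, f =1 g} -> derive1 f t = derive1 g t.
Proof. by move=> fg; rewrite !derive1E; exact: near_eq_derive. Qed.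

Lemma near_eq_derive1n V (f g : R -> V) n t :
  {near t, f =1 g} -> derive1n n f t = derive1n n g t.
Proof.
(* To differentiate once more, the induction hypothesis must hold on a neighbourhood; the goal is
   therefore strengthened to all points near [t]. *)
move=> fg; apply: (@nbhs_singleton _ t (fun t =>
  derive1n n f t = derive1n n g t)).
elim: n => [//|n /near_join]; apply: filterS => s fgs.
exact: near_eq_derive1.
Qed.

Lemma smooth_derive1n V (f : R -> V) n t : smooth f t ->
  smooth (derive1n n f) t.
Proof.
move=> sf; elim: n => [//|n IHn].
rewrite (_ : derive1n n.+1 f = fun t => 'D_1 (derive1n n f) t).
  exact: smooth_derive.
by apply/funext => s; rewrite /= -derive1E.
Qed.

Lemma derive1n_shift V (f : R -> V) n s t :
  derive1n n (fun u => f (s + u)) t = derive1n n f (s + t).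
Proof.
elim: n t => [//|n IHn] t; rewrite !derive1nS.
rewrite (_ : derive1n n _ = fun t => derive1n n f (s + t)); last exact/funext.
rewrite /derive1; set d := (fun _ : R => _); set d' := (fun _ : R => _).
suff -> : d = d' by [].
by apply/funext => h; rewrite /d /d' addrCA.
Qed.

Lemma derive1_comp_diff V W (f : R -> V) (g : V -> W) t : differentiable f t ->
  differentiable g (f t) -> derive1 (g \o f) t = 'D_(derive1 f t) g (f t).
Proof.
move=> df dg; rewrite !derive1E deriveE; last exact: differentiable_comp.
by rewrite diff_comp //= !deriveE.
Qed.

Lemma derive1_linear V W {fV : framed V} (f : R -> V) (l : {linear V -> W}) t :
  differentiable f t -> derive1 (l \o f) t = l (derive1 f t).
Proof.
move=> df; have lc : continuous l by exact: framed_linear_continuous.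
have dl y : differentiable l y by exact: linear_differentiable.
by rewrite (derive1_comp_diff df (dl _)) (deriveE _ (dl _)) diff_lin.
Qed.

(* Degree at most [n - 1], not [n]. *)
Definition taylor V (n : nat) (a : nat -> V) (t : R) : V :=
  \sum_(i < n) (t ^+ i / i`!%:R) *: a i.

Lemma smooth_exprn n (t : R) : smooth (fun s : R => s ^+ n) t.
Proof.
elim: n => [|n IHn]; first exact: (smooth_cst (1 : R)).
rewrite (_ : (fun s : R => _) = fun s => s *: (s ^+ n)).
  by apply: smooth_scale; [exact: smooth_id|].
by apply/funext => s; rewrite exprS.
Qed.

Lemma smooth_taylor V n (a : nat -> V) t : smooth (taylor n a) t.
Proof.
rewrite /taylor; apply: smooth_sum => i; apply: smooth_scale;
  last exact: smooth_cst.
rewrite (_ : (fun y : R => _) = fun y => (fun s : R =>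
  s ^+ i) y *: ((i`!)%:R^-1 : R)) //.
by apply: smooth_scale; [exact: smooth_exprn|exact: smooth_cst].
Qed.

Lemma taylor0 V n (a : nat -> V) : taylor n.+1 a 0 = a 0%N.
Proof.
rewrite /taylor big_ord_recl expr0 fact0 divr1 scale1r big1 ?addr0 // => i _.
by rewrite /bump /= expr0n mul0r scale0r.
Qed.

Lemma derive1_taylor V n (a : nat -> V) :
  derive1 (taylor n.+1 a) = taylor n (fun i => a i.+1).
Proof.
elim: n => [|n IHn].
  rewrite (_ : taylor 1 a = cst (a 0%N)); last first.
    by apply/funext => t; rewrite /taylor big_ord1 expr0 fact0 divr1 scale1r.
  by apply/funext => t; rewrite derive1_cst /taylor big_ord0.
apply/funext => t.
rewrite (_ : taylor n.+2 a = taylor n.+1 a +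
    (fun t => (t ^+ n.+1 / (n.+1)`!%:R) *: a n.+1)); last first.
  by apply/funext => s; rewrite [LHS]/taylor big_ord_recr.
have d1 : derivable (fun t : R => t ^+ n.+1 / (n.+1)`!%:R) t 1.
  by apply: derivableM => //; exact: exprn_derivable.
have dd : derivable (fun t : R => (t ^+ n.+1 / (n.+1)`!%:R) *: a n.+1) t 1.
  by apply: diff_derivable; apply: differentiableZl; exact/derivable1_diffP.
rewrite derive1E deriveD //; last first.
  by apply: diff_derivable; apply: smooth_diff; exact: smooth_taylor.
rewrite -derive1E IHn [RHS]/taylor big_ord_recr; congr (_ + _) => /=.
rewrite derive_scale; last 2 first.
- exact/derivable1_diffP.
- exact: differentiable_cst.
rewrite (derive_cst (a n.+1)) scaler0 add0r; congr (_ *: _).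
have -> : (fun t : R => t ^+ n.+1 / (n.+1)`!%:R) =
    ((n.+1)`!%:R^-1 : R) \*: (fun t : R => t ^+ n.+1).
  by apply/funext => s; rewrite /= mulrC.
rewrite deriveZ; last exact: exprn_derivable.
rewrite exp_derive /= factS natrM invfM [_ *: 1]mulr1.
rewrite -[LHS]/(_ * (_ * _)) mulrCA mulrA [X in X * _]mulrCA -mulrA.
by rewrite !mulrA mulVf ?pnatr_eq0 // mul1r mulrC.
Qed.

Lemma derive1n_taylor V n m (a : nat -> V) : (m <= n)%N ->
  derive1n m (taylor n.+1 a) 0 = a m.
Proof.
elim: m n a => [|m IHm] n a; first by rewrite derive1n0 taylor0.
by case: n => [//|n] mn; rewrite derive1Sn derive1_taylor IHm.
Qed.

End CurveCalculus.

Section JetTheory.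
Context {R : realType} (k : nat) (M : manifold R).
Hypothesis pM : premanifold M.
Implicit Types c b : R -> M.

Lemma same_jet_sym c b : same_jet k c b -> same_jet k b c.
Proof.
by move=> [E H]; split=> // phi; rewrite -E => /H{}H i /H.
Qed.

Lemma same_jet_trans c b d : same_jet k c b -> same_jet k b d -> same_jet k c d.
Proof.
move=> [E H] [E' H']; split=> [|phi cphi i ik]; first by rewrite E.
by rewrite H // H' // -E.
Qed.

Lemma same_jet_near c b : {near (0 : R), c =1 b} -> same_jet k c b.
Proof.
move=> cb; split; first exact: nbhs_singleton cb.
move=> phi _ i _; apply: near_eq_derive1n.
by apply: filterS cb => t /= ->.
Qed.

Lemma smooth_curve_near c b :
  {near (0 : R), c =1 b} -> smooth_curve c -> smooth_curve b.
Proof. exact: smooth_into_eq. Qed.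

Lemma jet_of_eq c b : smooth_curve c -> smooth_curve b -> same_jet k c b ->
  jet_of k c = jet_of k b.
Proof.
move=> sc sb cb; rewrite /jet_of.
case: pselect => // sc'; case: pselect => // sb'; apply: eq_exist.
apply/seteqP; split=> d [sd H]; split=> //.
  exact: same_jet_trans (same_jet_sym cb) H.
exact: same_jet_trans cb H.
Qed.

Lemma jet_of_near c b : smooth_curve c -> {near (0 : R), c =1 b} ->
  jet_of k c = jet_of k b.
Proof.
move=> sc cb; apply: jet_of_eq => //; first exact: smooth_curve_near sc.
exact: same_jet_near.
Qed.

Lemma jet_rep_smooth (X : jet k M) : smooth_curve (jet_rep X).
Proof. exact: s2valP (cid2 (svalP X)). Qed.
Arguments jet_rep_smooth : clear implicits.

Lemma jet_repK (X : jet k M) : jet_of k (jet_rep X) = X.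
Proof.
have EX : X = exist _ (sval X) (svalP X) by case: X => Y HY; exact: eq_exist.
have sX := jet_rep_smooth X; rewrite /jet_of; case: pselect => // sX'.
rewrite [RHS]EX; apply: eq_exist; exact: esym (s2valP' (cid2 (svalP X))).
Qed.

Lemma jet_of_inv c b : smooth_curve c -> smooth_curve b ->
  jet_of k c = jet_of k b -> same_jet k c b.
Proof.
move=> sc sb; rewrite /jet_of.
case: pselect => // sc'; case: pselect => // sb' /(congr1 sval) /= E.
have : jet_class k b b by split.
by rewrite -E => -[].
Qed.

Lemma jet_rep_of c : smooth_curve c -> same_jet k (jet_rep (jet_of k c)) c.
Proof.
move=> sc; apply: jet_of_inv => //; first exact: jet_rep_smooth.
exact: jet_repK.
Qed.

Lemma jet_rep_of0 c : smooth_curve c -> jet_rep (jet_of k c) 0 = c 0.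
Proof. by move=> /jet_rep_of[]. Qed.

Lemma jet_chart_of c phi : smooth_curve c -> charts_at (c 0) phi ->
  chart_map (jet_chart k phi) (jet_of k c) =
  mxvec (\matrix_(i < k.+1) derive1n i (chart_map phi \o c) 0).
Proof.
move=> sc cphi /=; congr mxvec; apply/row_matrixP => i; rewrite !rowK.
have [E ->] := jet_rep_of sc => //; last by rewrite -ltnS.
by rewrite E.
Qed.

(** The curve inside the [param] of [jet_chart], recast as a [taylor] polynomial; its coefficients
    are indexed by [nat], whence [inord]. *)
Definition jet_curve (phi : chart R M (mdim M)) (z : 'rV[R]_(k.+1 *
  mdim M)) : R -> M :=
  fun t => param phi (taylor k.+1 (fun i => row (inord i) (vec_mx z)) t).

Lemma jet_paramE phi z : param (jet_chart k phi) z = jet_of k (jet_curve phi z).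
Proof.
rewrite /= /jet_curve; congr jet_of; apply/funext => t; congr param.
by apply: eq_bigr => i _; rewrite inord_val.
Qed.

Lemma jet_curve0 phi z : jet_curve phi z 0 = param phi (row ord0 (vec_mx z)).
Proof.
rewrite /jet_curve taylor0; congr (param phi (row _ _)).
by apply/val_inj; rewrite /= inordK.
Qed.

Section CurveInChart.
Variables (phi : chart R M (mdim M)) (z : 'rV[R]_(k.+1 * mdim M)).
Hypotheses (aphi : atlas (m := M) phi) (tz : target phi (row ord0 (vec_mx z))).

Lemma jet_curve_chart : charts_at (jet_curve phi z 0) phi.
Proof. by rewrite jet_curve0; split=> //; have [] := pm_param pM aphi tz. Qed.

Lemma smooth_jet_curve : smooth_curve (jet_curve phi z).
Proof.
have [sp Ep] := pm_param pM aphi tz.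
apply: (smooth_into_comp (W := 'rV[R]_(mdim M)) (f := param phi)).
  exact: smooth_taylor.
rewrite taylor0 (_ : inord 0 = ord0); last by apply/val_inj; rewrite /= inordK.
by rewrite -[X in smooth_into _ X]Ep; exact: pm_transition.
Qed.

Lemma derive_jet_curve i : (i <= k)%N ->
  derive1n i (chart_map phi \o jet_curve phi z) 0 = row (inord i) (vec_mx z).
Proof.
move=> ik.
pose a j := row (inord j : 'I_k.+1) (vec_mx z).
rewrite -[RHS]/(a i) -(derive1n_taylor a ik); apply: near_eq_derive1n.
have : \forall t \near (0 : R), target phi (taylor k.+1 a t).
  apply: (smooth_continuous (smooth_taylor k.+1 a 0)).
  apply: open_nbhs_nbhs; split; first exact: pm_open_target.
  rewrite taylor0 /a (_ : inord 0 = ord0) //.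
  by apply/val_inj; rewrite /= inordK.
by apply: filterS => t tt /=; have [_] := pm_param pM aphi tt.
Qed.

End CurveInChart.

Lemma row_mxvecK (m n : nat) (A : 'I_m -> 'rV[R]_n) i :
  row i (vec_mx (mxvec (\matrix_i A i))) = A i.
Proof. by rewrite mxvecK rowK. Qed.

(** Chart independence of jets, isolated because its two proofs differ: for order 1 the ordinary
    chain rule ([jet1_invariant]), for order [k] on a group the detour through [T^k G]
    ([jet_invariant_lie]). *)
Definition jet_invariant := forall c b phi, smooth_curve c -> smooth_curve b ->
  c 0 = b 0 -> charts_at (c 0) phi ->
  (forall i, (i <= k)%N -> derive1n i (chart_map phi \o c) 0 =
                          derive1n i (chart_map phi \o b) 0) ->
  same_jet k c b.

Lemma jet_charts_of c Phi : smooth_curve c ->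
  charts_at (jet_of k c : jet_manifold k M) Phi ->
  exists2 phi, charts_at (c 0) phi & Phi = jet_chart k phi.
Proof.
by move=> sc [[phi aphi <-]] /=; rewrite jet_rep_of0 // => sphi; exists phi.
Qed.

Lemma jet_charts_at c phi : smooth_curve c -> charts_at (c 0) phi ->
  charts_at (jet_of k c : jet_manifold k M) (jet_chart k phi).
Proof.
by move=> sc [aphi sphi]; split; [exists phi|rewrite /= jet_rep_of0].
Qed.

Lemma jet_premanifold : jet_invariant ->
  (forall (p : jet_manifold k M) Phi, charts_at p Phi ->
    smooth_into (param Phi) (chart_map Phi p)) ->
  premanifold (jet_manifold k M).
Proof.
move=> inv trans; split=> //.
- move=> X; have [phi [aphi sphi]] := pm_cover pM (jet_rep X 0).
  by exists (jet_chart k phi); split=> //; exists phi.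
- move=> _ [phi aphi <-] /=.
  apply: (@open_comp _ _ (fun z => row ord0 (vec_mx z)) (target phi)).
    move=> z _.
    exact: (framed_linear_continuous (f :=
      (row ord0 \o vec_mx : {linear _ -> _}))).
  exact: pm_open_target.
- move=> _ [phi aphi <-] X sX.
  have cX : charts_at (jet_rep X 0) phi by split.
  have E0 : row ord0 (vec_mx (chart_map (jet_chart k phi) X)) =
      chart_map phi (jet_rep X 0) by rewrite /= row_mxvecK.
  have tX : target phi (row ord0 (vec_mx (chart_map (jet_chart k phi) X))).
    by rewrite E0; exact: chart_target.
  split=> //; rewrite jet_paramE -[RHS]jet_repK.
  apply: jet_of_eq; [exact: smooth_jet_curve|exact: jet_rep_smooth|].
  apply: (inv _ _ phi); [exact: smooth_jet_curve|exact: jet_rep_smooth| | |].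
  + by rewrite jet_curve0 E0 chart_paramK.
  + exact: jet_curve_chart.
  + move=> i ik; rewrite derive_jet_curve // row_mxvecK inordK //.
- move=> _ [phi aphi <-] z tz; rewrite jet_paramE.
  have sz := smooth_jet_curve aphi tz; have cz := jet_curve_chart aphi tz.
  split; first by have [] := jet_charts_at sz cz.
  rewrite jet_chart_of // -[RHS]vec_mxK; congr mxvec.
  apply/row_matrixP => i; rewrite rowK derive_jet_curve ?inord_val //.
  by rewrite -ltnS.
Qed.

End JetTheory.
Arguments jet_rep_smooth {R k M} X.

(** * The tangent group *)

Section FirstJets.
Context {R : realType}.
Implicit Types V W : normedModType R.
Implicit Types M : manifold R.

Lemma taylor2 V (a : nat -> V) t : taylor 2 a t = a 0%N + t *: a 1%N.
Proof.
rewrite /taylor !big_ord_recl big_ord0 /= expr0 fact0 divr1 scale1r addr0.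
by rewrite expr1 (_ : 1`! = 1)%N // divr1.
Qed.

Lemma smooth_affine V (a b : V) (t : R) : smooth (fun s : R => a + s *: b) t.
Proof.
apply: smoothD; first exact: smooth_cst.
by apply: smooth_scale; [exact: smooth_id|exact: smooth_cst].
Qed.

Lemma smooth_mxvec_rows V m n (g : 'I_m -> V -> 'rV[R]_n) x :
  (forall i, smooth (g i) x) -> smooth (fun y => mxvec (\matrix_i g i y)) x.
Proof.
move=> hg; apply: (smooth_comp (f := fun y => \matrix_i g i y) (g := mxvec)).
  apply: smooth_mx => i j.
  rewrite (_ : (fun y => _) = (fun v : 'rV[R]_n => v 0 j) \o g i); last first.
    by apply/funext => y /=; rewrite mxE.
  apply: (smooth_comp (hg i)).
  have lin : linear (fun v : 'rV[R]_n => v 0 j) by move=> a u v; rewrite !mxE.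
  pose L : {linear 'rV[R]_n -> R} :=
    HB.pack (fun v : 'rV[R]_n => v 0 j) (GRing.isLinear.Build _ _ _ _ _ lin).
  exact: (smooth_linear L).
exact: smooth_linear.
Qed.

(** The chain rule at order one: only the value and the velocity of the inner curve matter. For [f]
    a parametrization, a product or an inverse, it shows that chart independence and the group
    operations pass to 1-jets. *)
Lemma same_jet_comp V M (f : V -> M) (u w : R -> V) : smooth_into f (u 0) ->
  smooth u 0 -> smooth w 0 -> u 0 = w 0 -> derive1 u 0 = derive1 w 0 ->
  same_jet 1 (f \o u) (f \o w).
Proof.
move=> sf su sw E0 E1; split; first by rewrite /= E0.
move=> phi cphi [|[|i]] i1; last by case: (notF i1).
  by rewrite !derive1n0 /= E0.
have [_ /smooth_diff df] := sf _ cphi.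
rewrite !derive1n1 (derive1_comp_diff (smooth_diff su) df).
have df' : differentiable (chart_map phi \o f) (w 0) by rewrite -E0.
by rewrite (derive1_comp_diff (smooth_diff sw) df') -E0 -E1.
Qed.

Lemma jet1_invariant M : premanifold M -> jet_invariant 1 M.
Proof.
move=> pM c b phi sc sb E0 cphi E.
have cphib : charts_at (b 0) phi by rewrite -E0.
have near_param d : smooth_curve d -> charts_at (d 0) phi ->
    {near (0 : R), param phi \o (chart_map phi \o d) =1 d}.
  move=> sd cd; have [srcd _] := sd _ cd.
  apply: filterS srcd => t st /=; apply: (chart_paramK pM); split=> //.
  by case: cphi.
have [_ sc'] := sc _ cphi; have [_ sb'] := sb _ cphib.
apply: (same_jet_trans (same_jet_sym (same_jet_near 1 (near_param _ sc cphi)))).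
apply: same_jet_trans (same_jet_near 1 (near_param _ sb cphib)).
apply: (same_jet_comp _ sc' sb' (E 0%N isT) (E 1%N isT)).
exact: pm_transition.
Qed.

(* For [f] a parametrization, the product or the inverse, both read in charts,
   this yields the transition maps and the group operations of [jet_group 1]. *)
Lemma smooth_into_tangent V M {fV : framed V} (f : V -> M) (x y : V) :
  premanifold M -> smooth_into f x ->
  smooth_into (fun p : V * V =>
    jet_of 1 (fun t => f (p.1 + t *: p.2)) : jet_manifold 1 M) (x, y).
Proof.
move=> pM sf Phi.
pose c (p : V * V) t := f (p.1 + t *: p.2).
have c0 p : c p 0 = f p.1 by rewrite /c scale0r addr0.
have sc p : smooth_into f p.1 -> smooth_curve (c p).
  move=> sfp; apply: (smooth_into_comp (W := V)); first exact: smooth_affine.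
  by rewrite scale0r addr0.
move=> /(jet_charts_of (sc (x, y) sf))[phi]; rewrite c0 /= => cphi ->.
have [src sm] := sf _ cphi.
have nf : \forall p \near (x, y), smooth_into f p.1.
  have /cvg_fst : nbhs x [set z | smooth_into f z] by exact: smooth_into_near.
  by apply.
have nsrc : \forall p \near (x, y), source phi (f p.1).
  by have /cvg_fst := src; apply.
split.
  by apply: filterS2 nf nsrc => p sfp srcp /=;
    rewrite (jet_rep_of0 1 (sc p sfp)) c0.
pose g (i : 'I_2) (p : V * V) :=
  if i == 0 then chart_map phi (f p.1) else 'D_(p.2) (chart_map phi \o f) p.1.
have sg : smooth (fun p => mxvec (\matrix_(i < 2) g i p)) (x, y).
  apply: smooth_mxvec_rows => i; rewrite /g; case: eqP => _.
    exact: (smooth_comp (smooth_fst (x, y)) sm).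
  exact: smooth_tangent.
apply: smooth_eq sg.
apply: filterS2 nf nsrc => p sfp srcp.
have cp : charts_at (c p 0) phi by rewrite c0; split=> //; case: cphi.
rewrite [RHS](jet_chart_of 1 (sc p sfp) cp); congr mxvec.
apply/row_matrixP => -[[|[|//]] i2]; rewrite !rowK /g /=.
  by rewrite c0.
have [_ smp] := sfp _ (conj cphi.1 srcp).
rewrite -[chart_map phi \o c p]/((chart_map phi \o f) \o (fun t
  => p.1 + t *: p.2)).
rewrite derive1_comp_diff; last 2 first.
- by apply: smooth_diff; exact: smooth_affine.
- by rewrite scale0r addr0; exact: smooth_diff.
rewrite scale0r addr0; congr ('D_ _ _ _).
pose a i := if i is 0%N then p.1 else p.2.
have -> : (fun t : R => p.1 + t *: p.2) = taylor 2 a.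
  by apply/funext => t; rewrite taylor2.
exact: esym (derive1n_taylor a (leqnn 1)).
Qed.

Definition row_pair n (z : 'rV[R]_(2 * n)) : 'rV[R]_n * 'rV[R]_n :=
  (row 0 (vec_mx z), row 1 (vec_mx z)).

Lemma smooth_row V m n (h : V -> 'rV[R]_(m * n)) i x :
  smooth h x -> smooth (fun y => row i (vec_mx (h y))) x.
Proof.
move=> sh; apply: (smooth_comp (g := fun z => row i (vec_mx z)) sh).
exact: (smooth_linear ((row i \o vec_mx) : {linear 'rV[R]_(m
  * n) -> 'rV[R]_n})).
Qed.

Lemma jet_curve1E M (phi : chart R M (mdim M)) (z : 'rV[R]_(2 * mdim M)) :
  jet_curve phi z =
  fun t => param phi ((row_pair z).1 + t *: (row_pair z).2).
Proof.
apply/funext => t; rewrite /jet_curve taylor2 /row_pair /=.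
have -> : inord 0 = 0 :> 'I_2 by apply/val_inj; rewrite /= inordK.
by have -> : inord 1 = 1 :> 'I_2 by apply/val_inj; rewrite /= inordK.
Qed.

Lemma jet1_premanifold M : premanifold M -> premanifold (jet_manifold 1 M).
Proof.
move=> pM; apply: jet_premanifold => //; first exact: jet1_invariant.
move=> X _ [[phi aphi <-] /= sX].
set z0 := mxvec _.
have Ez0 : (row_pair z0).1 = chart_map phi (jet_rep X 0) by rewrite
  /row_pair /z0 row_mxvecK.
rewrite (_ : (fun z => _) = (fun p => jet_of 1 (fun t =>
  param phi (p.1 + t *: p.2))) \o
   @row_pair (mdim M)); last first.
  apply/funext => z; rewrite -[LHS]/(param (jet_chart 1 phi) z) jet_paramE.
  by rewrite jet_curve1E.
apply: (smooth_into_comp (W := ('rV[R]_(mdim M) * 'rV[R]_(mdim M))%type)).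
  by apply: smooth_pair; apply: smooth_row; exact: smooth_id.
rewrite [row_pair z0]surjective_pairing; apply: smooth_into_tangent => //.
by rewrite Ez0; exact: pm_transition.
Qed.

End FirstJets.

Section TangentLie.
Context {R : realType} (G : lieGroup R).
Hypothesis pG : prelie G.
Let pM := pl_premanifold pG.
Implicit Types c b : R -> G.

Lemma smooth_curve_mul c b : smooth_curve c -> smooth_curve b ->
  smooth_curve (fun t => lmul (c t) (b t)).
Proof. exact: smooth_into_mul. Qed.

Lemma smooth_curve_inv c : smooth_curve c -> smooth_curve (fun t => linv (c t)).
Proof. exact: smooth_into_inv. Qed.

Lemma near_param c phi : smooth_curve c -> charts_at (c 0) phi ->
  {near (0 : R), param phi \o (chart_map phi \o c) =1 c}.
Proof.
move=> sc cphi; have [srcd _] := sc _ cphi.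
apply: filterS srcd => t st /=; apply: (chart_paramK pM); split=> //.
by case: cphi.
Qed.

Lemma derive1_pair (V W : normedModType R) (f : R -> V) (g : R -> W) t :
  differentiable f t -> differentiable g t ->
  derive1 (fun t => (f t, g t)) t = (derive1 f t, derive1 g t).
Proof.
move=> df dg; rewrite !derive1E !deriveE ?diff_pair //.
exact: differentiable_pair.
Qed.

Lemma same_jet_mul c c' b b' : smooth_curve c -> smooth_curve c' ->
  smooth_curve b -> smooth_curve b' -> same_jet 1 c c' -> same_jet 1 b b' ->
  same_jet 1 (fun t => lmul (c t) (b t)) (fun t => lmul (c' t) (b' t)).
Proof.
move=> sc sc' sb sb' [c0 jc] [b0 jb].
have [phi cphi] := pm_cover pM (c 0); have [psi cpsi] := pm_cover pM (b 0).
have [_ smc] := sc _ cphi; have [_ smb] := sb _ cpsi.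
have := sc' phi; rewrite -c0 => /(_ cphi)[_ smc'].
have := sb' psi; rewrite -b0 => /(_ cpsi)[_ smb'].
pose f (z : 'rV[R]_(mdim G) * 'rV[R]_(mdim G)) :=
  lmul (param phi z.1) (param psi z.2).
pose u t := ((chart_map phi \o c) t, (chart_map psi \o b) t).
pose w t := ((chart_map phi \o c') t, (chart_map psi \o b') t).
have nu : {near (0 : R), f \o u =1 fun t => lmul (c t) (b t)}.
  by apply: filterS2 (near_param sc cphi) (near_param sb cpsi) => t /= e1 e2;
    rewrite /f /= e1 e2.
have nw : {near (0 : R), f \o w =1 fun t => lmul (c' t) (b' t)}.
  have := cphi; have := cpsi; rewrite c0 b0 => cpsi' cphi'.
  by apply: filterS2 (near_param sc' cphi') (near_param sb'
    cpsi') => t /= e1 e2;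
    rewrite /f /= e1 e2.
apply: (same_jet_trans (same_jet_sym (same_jet_near 1 nu))).
apply: same_jet_trans (same_jet_near 1 nw).
apply: same_jet_comp.
- exact: pl_smooth_mul.
- exact: smooth_pair.
- exact: smooth_pair.
- by rewrite /u /w /= c0 b0.
rewrite !derive1_pair; try exact: smooth_diff.
have := jc _ cphi 1%N isT; have := jb _ cpsi 1%N isT.
by rewrite !derive1n1 => -> ->.
Qed.

Lemma jet_of_mul c b : smooth_curve c -> smooth_curve b ->
  @lmul R (jet_group 1 G) (jet_of 1 c) (jet_of 1 b) =
  jet_of 1 (fun t => lmul (c t) (b t)).
Proof.
move=> sc sb; apply: jet_of_eq.
- by apply: smooth_curve_mul; exact: jet_rep_smooth.
- exact: smooth_curve_mul.
by apply: same_jet_mul => //; try exact: jet_rep_smooth; exact: jet_rep_of.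
Qed.

Lemma same_jet_inv c c' : smooth_curve c ->
  smooth_curve c' -> same_jet 1 c c' ->
  same_jet 1 (fun t => linv (c t)) (fun t => linv (c' t)).
Proof.
move=> sc sc' [c0 jc]; have [phi cphi] := pm_cover pM (c 0).
have [_ smc] := sc _ cphi.
have := sc' phi; rewrite -c0 => /(_ cphi)[_ smc'].
pose f := @linv R G \o param phi.
have nu : {near (0 : R), f \o (chart_map phi \o c) =1 fun t => linv (c t)}.
  by apply: filterS (near_param sc cphi) => t /= e; rewrite /f /= e.
have nw : {near (0 : R), f \o (chart_map phi \o c') =1 fun t => linv (c' t)}.
  have := cphi; rewrite c0 => cphi'.
  by apply: filterS (near_param sc' cphi') => t /= e; rewrite /f /= e.
apply: (same_jet_trans (same_jet_sym (same_jet_near 1 nu))).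
apply: same_jet_trans (same_jet_near 1 nw).
apply: (same_jet_comp _ smc smc' _ (jc _ cphi 1%N isT)); last by rewrite /= c0.
exact: (@pl_smooth_inv _ _ pG (c 0)).
Qed.

Lemma jet_of_lone : lone (jet_group 1 G) = jet_of 1 (cst (lone G)).
Proof. by []. Qed.

Lemma jet_of_linv c : smooth_curve c ->
  @linv R (jet_group 1 G) (jet_of 1 c) = jet_of 1 (fun t => linv (c t)).
Proof.
move=> sc; apply: jet_of_eq.
- by apply: smooth_curve_inv; exact: jet_rep_smooth.
- exact: smooth_curve_inv.
by apply: same_jet_inv => //; [exact: jet_rep_smooth|exact: jet_rep_of].
Qed.

Lemma smooth_curve1 : smooth_curve (cst (lone G)).
Proof. exact: smooth_curve_cst. Qed.

Lemma jet_group_prelie : prelie (jet_group 1 G).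
Proof.
have pJ := jet1_premanifold pM.
have sr (X : jet_group 1 G) : smooth_curve (jet_rep X) := jet_rep_smooth X.
split=> //.
- move=> X Y Z; rewrite -[X]jet_repK -[Y]jet_repK -[Z]jet_repK.
  rewrite !jet_of_mul //; try exact: smooth_curve_mul.
  by congr jet_of; apply/funext => t; exact: pl_mulA.
- move=> X; rewrite -[X]jet_repK jet_of_lone jet_of_mul //;
  last exact: smooth_curve1.
  by congr jet_of; apply/funext => t; exact: pl_mul1.
- move=> X; rewrite -[X]jet_repK jet_of_linv // jet_of_mul //;
  last exact: smooth_curve_inv.
  by congr jet_of; apply/funext => t; exact: pl_mulV.
- move=> X Y Phi Psi cPhi cPsi.
  have tPhi := near_target pJ cPhi; have tPsi := near_target pJ cPsi.
  case: cPhi cPsi tPhi tPsi => -[phi aphi <-] sX [[psi apsi <-] sY].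
  set x0 := chart_map _ X; set y0 := chart_map _ Y => tPhi tPsi.
  pose V := ('rV[R]_(mdim G) * 'rV[R]_(mdim G))%type.
  pose f (z : V) := lmul (param phi z.1) (param psi z.2).
  (* Regroups two tangent vectors into a pair of base points and a pair of directions: this is the
     identification of [TG * TG] with [T(G * G)] in coordinates. *)
  pose h (z : 'rV[R]_(2 * mdim G) * 'rV[R]_(2 * mdim G)) : V * V :=
    (((row_pair z.1).1, (row_pair z.2).1),
      ((row_pair z.1).2, (row_pair z.2).2)).
  have Ex0 : (row_pair x0).1 = chart_map phi (jet_rep X 0).
    by rewrite /row_pair /x0 /= row_mxvecK.
  have Ey0 : (row_pair y0).1 = chart_map psi (jet_rep Y 0).
    by rewrite /row_pair /y0 /= row_mxvecK.
  apply: (@smooth_into_eq _ (jet_manifold 1 G) _ ((fun p : V * V =>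
    jet_of 1 (fun t : R => f (p.1 + t *: p.2))) \o h) _ (x0, y0)).
    have n1 : \forall z \near (x0, y0), target (jet_chart 1 phi) z.1.
      by have /cvg_fst := tPhi; apply.
    have n2 : \forall z \near (x0, y0), target (jet_chart 1 psi) z.2.
      by have /cvg_snd := tPsi; apply.
    apply: filterS2 n1 n2 => z t1 t2.
    rewrite [RHS](_ : _ = @lmul R (jet_group 1 G) (jet_of 1
      (jet_curve (k := 1) phi z.1))
      (jet_of 1 (jet_curve (k := 1) psi z.2))); last by rewrite -!jet_paramE.
    rewrite jet_of_mul; [|exact: smooth_jet_curve|exact: smooth_jet_curve].
    by rewrite !jet_curve1E.
  apply: (smooth_into_comp (W := (V * V)%type)); last first.
    rewrite [h _]surjective_pairing; apply: smooth_into_tangent => //.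
    rewrite -[X in smooth_into _ X]/((row_pair x0).1, (row_pair y0).1) Ex0 Ey0.
    exact: pl_smooth_mul.
  by do 2 apply: smooth_pair; apply: smooth_row;
    (exact: smooth_fst || exact: smooth_snd).
- move=> X Phi cPhi; have tPhi := near_target pJ cPhi.
  case: cPhi tPhi => -[phi aphi <-] sX; set x0 := chart_map _ X => tPhi.
  have Ex0 : (row_pair x0).1 = chart_map phi (jet_rep X 0).
    by rewrite /row_pair /x0 /= row_mxvecK.
  pose V := 'rV[R]_(mdim G).
  pose f (z : V) := linv (param phi z).
  apply: (@smooth_into_eq _ (jet_manifold 1 G) _ ((fun p : V * V =>
    jet_of 1 (fun t : R => f (p.1 + t *: p.2))) \o
     @row_pair _ (mdim G)) _ x0).
    apply: filterS tPhi => z tz.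
    rewrite [RHS](_ : _ = @linv R (jet_group 1 G) (jet_of 1 (jet_curve (k :=
      1) phi z))); last first.
      by rewrite -!jet_paramE.
    rewrite jet_of_linv; last exact: smooth_jet_curve.
    by rewrite !jet_curve1E.
  apply: (smooth_into_comp (W := (V * V)%type)).
    by apply: smooth_pair; apply: smooth_row; exact: smooth_id.
  rewrite [row_pair _]surjective_pairing; apply: smooth_into_tangent => //.
  by rewrite Ex0; exact: pl_smooth_inv.
Qed.

End TangentLie.

Lemma tangent_prelie (R : realType) (G : lieGroup R) k :
  prelie G -> prelie (tangent_group G k).
Proof. by move=> pG; elim: k => [//|k IHk]; exact: jet_group_prelie. Qed.

(** * Jets in the iterated tangent group *)

Section LiftSets.
Variable k : nat.
Implicit Types (A : {set 'I_k.+1}) (B : {set 'I_k}).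

(** The set [B] of [right_triv]. Together with the membership of [ord_max] it encodes [A], so that
    the recursion on index sets follows the one on [k]. *)
Definition lower A : {set 'I_k} := [set i | lift ord_max i \in A]%SET.

Definition raise (b : bool) B : {set 'I_k.+1} :=
  [set i | if unlift ord_max i is Some j then j \in B else b]%SET.

Lemma raise_max b B : (ord_max \in raise b B) = b.
Proof. by rewrite inE unlift_none. Qed.

Lemma raiseK b B : lower (raise b B) = B.
Proof. by apply/setP => i; rewrite !inE liftK. Qed.

Lemma card_lower A : #|A| = (#|lower A| + (ord_max \in A))%N.
Proof.
rewrite -!sum1_card !(big_mkcond (fun i => i \in _)) big_ord_recr /=.
congr (_ + _)%N.
apply: eq_bigr => i _;
  rewrite inE (_ : lift ord_max i = widen_ord (leqnSn k) i) //.
by apply: val_inj; rewrite /= /bump leqNgt ltn_ord.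
Qed.

Lemma lower0 A : (lower A == finset.set0) && (ord_max \notin A)
  = (A == finset.set0).
Proof. by rewrite -!cards_eq0 card_lower addn_eq0; case: (ord_max \in A). Qed.

End LiftSets.

Section TangentCharts.
Context {R : realType} (G : lieGroup R).
Local Notation T k := (tangent_group G k).
Implicit Types (V : normedModType R) (phi : chart R G (mdim G)).

Fixpoint tchart k phi : chart R (T k) (mdim (T k)) :=
  match k with
  | 0 => phi
  | j.+1 => jet_chart 1 (tchart j phi)
  end.

(* Coordinates in [T k] of the class of [c (t_1 + .. + t_k)], where [a i] is the
   [i]-th derivative of [c] at [0] in a chart. *)
Fixpoint tlift k (a : nat -> 'rV[R]_(mdim G)) : 'rV[R]_(mdim (T k)) :=
  match k with
  | 0 => a 0%N
  | j.+1 => mxvec (\matrix_(i < 2) tlift j (fun m => a (m + i)%N))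
  end.

(** For the class of a [k]-parameter family, this block of the coordinates is the mixed partial
    derivative, once in each parameter of index in [A], with [ord_max] the outermost tangent
    step. *)
Fixpoint tproj k : {set 'I_k} -> 'rV[R]_(mdim (T k)) -> 'rV[R]_(mdim G) :=
  match k with
  | 0 => fun _ z => z
  | j.+1 => fun A z =>
      tproj (lower A) (row (if ord_max \in A then 1 else 0 : 'I_2) (vec_mx z))
  end.

Lemma tproj_is_linear k (A : {set 'I_k}) : linear (tproj A).
Proof.
elim: k A => [//|k IHk] A a z w /=.
by rewrite !linearP IHk.
Qed.

HB.instance Definition _ k (A : {set 'I_k}) :=
  GRing.isLinear.Build _ _ _ _ (tproj A) (tproj_is_linear A).

Lemma tprojK k (A : {set 'I_k}) a : tproj A (tlift k a) = a #|A|.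
Proof.
elim: k A a => [|k IHk] A a /=.
  by rewrite eq_card0 // => -[].
by rewrite row_mxvecK IHk card_lower; case: (ord_max \in A).
Qed.

Lemma tproj_inj k (z w : 'rV[R]_(mdim (T k))) :
  (forall A, tproj A z = tproj A w) -> z = w.
Proof.
elim: k z w => [|k IHk] z w H; first exact: (H finset.set0).
rewrite -[z]vec_mxK -[w]vec_mxK; congr mxvec; apply/row_matrixP => i.
have E b : row (if b then 1 else 0 : 'I_2) (vec_mx z) =
           row (if b then 1 else 0 : 'I_2) (vec_mx w).
  by apply: IHk => B; have := H (raise b B); rewrite /= raiseK raise_max.
have -> : i = (if (i : nat) == 1%N then 1 else 0) :> 'I_2.
  by apply/val_inj; case: i => -[|[|]].
exact: E.
Qed.

Lemma eq_tlift k a b : (forall i,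
  (i <= k)%N -> a i = b i) -> tlift k a = tlift k b.
Proof.
elim: k a b => [|k IHk] a b ab /=; first exact: ab.
congr mxvec; apply/row_matrixP => i; rewrite !rowK; apply: IHk => m mk.
by apply: ab; rewrite -[k.+1]addn1; apply: leq_add => //; rewrite -ltnS.
Qed.

Lemma smooth_tlift V k (u : nat -> V -> 'rV[R]_(mdim G)) x :
  (forall i, smooth (u i) x) -> smooth (fun y => tlift k (fun i => u i y)) x.
Proof.
elim: k u => [|k IHk] u su //=.
by apply: smooth_mxvec_rows => i; apply: (IHk (fun m => u (m + i)%N)).
Qed.

Definition initial k i : {set 'I_k} := [set j : 'I_k | (j < i)%N]%SET.

Lemma card_initial k i : (i <= k)%N -> #|initial k i| = i.
Proof.
move=> ik; rewrite -sum1_card.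
rewrite (eq_bigl (fun j : 'I_k => (j < i)%N)); last by move=> j; rewrite inE.
by rewrite -(big_ord_widen k (fun=> 1%N) ik) sum1_card card_ord.
Qed.

(** A linear left inverse of [tlift]: on the image of [tlift] the blocks depend only on the
    cardinality, so one set [initial k i] is sampled for each order [i]. *)
Definition tretract k (z : 'rV[R]_(mdim (T k))) : 'rV[R]_(k.+1 * mdim G) :=
  mxvec (\matrix_(i < k.+1) tproj (initial k i) z).

Lemma tretractK k a : tretract (tlift k a) = mxvec (\matrix_(i < k.+1) a i).
Proof.
congr mxvec; apply/row_matrixP => i; rewrite !rowK tprojK card_initial //.
by rewrite -ltnS.
Qed.

Lemma smooth_tretract k z : smooth (@tretract k) z.
Proof. by apply: smooth_mxvec_rows => i; exact: smooth_linear. Qed.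

Fixpoint tbase k : T k -> G :=
  match k with
  | 0 => fun v => v
  | j.+1 => fun X : jet 1 (T j) => tbase (jet_rep X 0)
  end.

(** The class of [c (t_1 + ... + t_k)], with the sum produced one translation at a time so that only
    curves of one variable occur. *)
Fixpoint tjet k (c : R -> G) : T k :=
  match k with
  | 0 => c 0
  | j.+1 => jet_of 1 (fun t => tjet j (fun s => c (t + s)))
  end.

Hypothesis pG : prelie G.
Let pM := pl_premanifold pG.
Let pT k : prelie (T k) := tangent_prelie k pG.
Let pTM k : premanifold (T k) := pl_premanifold (pT k).
Implicit Types c b : R -> G.

Lemma smooth_curve_shift c t : smooth_into (c : R^o -> G) t ->
  smooth_curve (fun s => c (t + s)).
Proof.
move=> sc; apply: (smooth_into_comp (W := R)); first exact: smooth_shift.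
by rewrite addr0.
Qed.

Lemma near_shift_curve c : smooth_curve c ->
  \forall t \near (0 : R), smooth_curve (fun s => c (t + s)).
Proof.
move=> sc; apply: filterS (smooth_into_near pM sc) => t.
exact: smooth_curve_shift.
Qed.

(** The three claims are proved together: the chart formula at level [k.+1] differentiates the curve
    of translates at level [k], which must be smooth, and smoothness is itself read off the chart
    formula at nearby times. *)
Lemma tjet_smooth_chart k c phi : smooth_curve c -> charts_at (c 0) phi ->
  [/\ charts_at (tjet k c) (tchart k phi),
      chart_map (tchart k phi) (tjet k c) =
        tlift k (fun i => derive1n i (chart_map phi \o c) 0) &
      smooth_curve (fun t => tjet k (fun s => c (t + s)))].
Proof.
elim: k c => [|k IHk] c sc cphi.
  split=> //=; rewrite (_ : (fun t => _) = c) //.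
  by apply/funext => t; rewrite addr0.
have Ec : (fun s => c (0 + s)) = c by apply/funext => s; rewrite add0r.
(* Stated for every curve [b], since the smoothness claim applies it to all translates of [c] by
   small times. *)
have at_succ b : smooth_curve b -> charts_at (b 0) phi ->
    charts_at (tjet k.+1 b) (tchart k.+1 phi) /\
    chart_map (tchart k.+1 phi) (tjet k.+1 b) =
      tlift k.+1 (fun i => derive1n i (chart_map phi \o b) 0).
  move=> sb bphi; have [cT eT sT] := IHk _ sb bphi.
  have Eb : (fun s => b (0 + s)) = b by apply/funext => s; rewrite add0r.
  have cT0 : charts_at (tjet k (fun s =>
    b (0 + s))) (tchart k phi) by rewrite Eb.
  split; first exact: (jet_charts_at 1 sT cT0).
  rewrite [LHS](jet_chart_of 1 sT cT0) /=; congr mxvec.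
  apply/row_matrixP => i; rewrite !rowK.
  have [_ smb] := sb _ bphi.
  have near_b : {near (0 : R), chart_map (tchart k phi) \o
      (fun t => tjet k (fun s => b (t + s))) =1
      fun t => tlift k (fun m => derive1n m (chart_map phi \o b) t)}.
    have [srcb _] := sb _ bphi.
    apply: filterS2 (near_shift_curve sb) srcb => t sbt srct /=.
    have bt : charts_at (b (t + 0)) phi by rewrite addr0;
      split=> //; case: bphi.
    have [_ -> _] := IHk _ sbt bt; apply: eq_tlift => m _.
    by rewrite (derive1n_shift (chart_map phi \o b)) addr0.
  have su m : smooth (derive1n m (chart_map phi \o b)) 0 by
    exact: smooth_derive1n.
  case: i => -[|[|i]] i2; last by case: (notF i2).
    rewrite /= Eb eT; apply: eq_tlift => m _.
    by rewrite addn0.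
  (* Blockwise, [tlift] is a derivative of order [#|A|], and one further derivative is the shift by
     [i = 1] in its definition. *)
  rewrite derive1n1 (near_eq_derive1 near_b); apply: tproj_inj => A.
  rewrite tprojK -[LHS](derive1_linear (tproj A)); last first.
    by apply: smooth_diff; exact: smooth_tlift.
  rewrite (_ : tproj A \o _ = derive1n #|A| (chart_map phi \o b)); last first.
    by apply/funext => t /=; rewrite tprojK.
  by rewrite -derive1nS addn1.
have [cT eT] := at_succ _ sc cphi; split=> //.
have [srcc smc] := sc _ cphi.
have cT0 : charts_at (tjet k.+1 (fun s =>
  c (0 + s))) (tchart k.+1 phi) by rewrite Ec.
apply: (smooth_into_chart (pTM k.+1) cT0).
  apply: filterS2 (near_shift_curve sc) srcc => t sct srct.
  have bt : charts_at (c (t + 0)) phi by rewrite addr0; split=> //; case: cphi.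
  by have [[]] := at_succ _ sct bt.
have s1 : smooth (fun t : R => tlift k.+1 (fun m =>
  derive1n m (chart_map phi \o c) t)) 0.
  by apply: (@smooth_tlift _ k.+1 (fun m => derive1n m (chart_map phi \o c))) =>
    m; exact: smooth_derive1n.
apply: smooth_eq s1.
apply: filterS2 (near_shift_curve sc) srcc => t sct srct.
have bt : charts_at (c (t + 0)) phi by rewrite addr0; split=> //; case: cphi.
have [_ e] := at_succ _ sct bt.
rewrite [RHS]e; apply: eq_tlift => m _.
by rewrite (derive1n_shift (chart_map phi \o c)) addr0.
Qed.

End TangentCharts.

Section JetsInTangent.
Context {R : realType} (G : lieGroup R).
Local Notation T k := (tangent_group G k).
Implicit Types (phi : chart R G (mdim G)) (c b : R -> G).
Hypothesis pG : prelie G.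
Let pM := pl_premanifold pG.
Let pT k : prelie (T k) := tangent_prelie k pG.
Let pTM k : premanifold (T k) := pl_premanifold (pT k).

Lemma tjet_charts_at k c phi : smooth_curve c -> charts_at (c 0) phi ->
  charts_at (tjet k c) (tchart k phi).
Proof. by move=> sc cphi; have [] := tjet_smooth_chart pG k sc cphi. Qed.

Lemma tjet_chart k c phi : smooth_curve c -> charts_at (c 0) phi ->
  chart_map (tchart k phi) (tjet k c) =
  tlift k (fun i => derive1n i (chart_map phi \o c) 0).
Proof. by move=> sc cphi; have [] := tjet_smooth_chart pG k sc cphi. Qed.

Lemma tjet_smooth k c : smooth_curve c ->
  smooth_curve (fun t => tjet k (fun s => c (t + s))).
Proof.
move=> sc; have [phi cphi] := pm_cover pM (c 0).
by have [] := tjet_smooth_chart pG k sc cphi.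
Qed.

Lemma tjet_eq k c b phi : smooth_curve c -> smooth_curve b -> c 0 = b 0 ->
  charts_at (c 0) phi ->
  (forall i, (i <= k)%N -> derive1n i (chart_map phi \o c) 0 =
                          derive1n i (chart_map phi \o b) 0) ->
  tjet k c = tjet k b.
Proof.
move=> sc sb E0 cphi E; have bphi := cphi; rewrite E0 in bphi.
apply: (chart_inj (pTM k) (tjet_charts_at k sc cphi)
  (tjet_charts_at k sb bphi)).
by rewrite !tjet_chart //; exact: eq_tlift.
Qed.

Lemma tjet_same_jet k c b : smooth_curve c -> smooth_curve b ->
  same_jet k c b -> tjet k c = tjet k b.
Proof.
move=> sc sb [E0 E]; have [phi cphi] := pm_cover pM (c 0).
by apply: (tjet_eq sc sb E0 cphi); exact: E.
Qed.

Lemma tbase_tjet k c : smooth_curve c -> tbase (tjet k c) = c 0.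
Proof.
elim: k c => [//|k IHk] c sc /=; rewrite jet_rep_of0; last exact: tjet_smooth.
have Ec : (fun s => c (0 + s)) = c by apply/funext => s; rewrite add0r.
by rewrite Ec IHk.
Qed.

Lemma tjet_inj k c b : smooth_curve c -> smooth_curve b ->
  tjet k c = tjet k b -> same_jet k c b.
Proof.
move=> sc sb E; have E0 : c 0 = b 0 by rewrite -(tbase_tjet k sc) E tbase_tjet.
split=> // phi cphi i ik; have bphi := cphi; rewrite E0 in bphi.
have := tjet_chart k sc cphi;
  rewrite E tjet_chart // => /(congr1 (tproj (initial k i))).
by rewrite !tprojK card_initial.
Qed.

(** Replaces the higher-order chain rule: equal derivatives in one chart give the same point of
    [T^k G], and from that point the derivatives can be recovered in any chart. *)
Lemma jet_invariant_lie k : jet_invariant k G.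
Proof.
move=> c b phi sc sb E0 cphi E; apply: tjet_inj => //; exact: tjet_eq cphi E.
Qed.

Lemma tjet1 k : tjet k (cst (lone G)) = lone (T k).
Proof. by elim: k => [//|k /= <-]. Qed.

Lemma tjet_rep_base k c : smooth_curve c ->
  jet_rep (tjet k.+1 c : jet 1 (T k)) 0 = tjet k c.
Proof.
move=> sc; rewrite /= jet_rep_of0; last exact: tjet_smooth.
by congr tjet; apply/funext => s; rewrite add0r.
Qed.

Lemma tjet_mul k c b : smooth_curve c -> smooth_curve b ->
  tjet k (fun t => lmul (c t) (b t)) = lmul (tjet k c) (tjet k b).
Proof.
elim: k c b => [//|k IHk] c b sc sb.
have scb := smooth_curve_mul pG sc sb.
apply: etrans (esym (jet_of_mul (pT k) (@tjet_smooth k _ sc)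
  (@tjet_smooth k _ sb))).
(* The curves are known to be smooth only near [0], so the induction hypothesis covers only small
   translates; this is enough to determine the jet. *)
apply: jet_of_near; first exact: tjet_smooth scb.
apply: filterS2 (near_shift_curve pG sc) (near_shift_curve pG sb) => t sct sbt.
exact: IHk.
Qed.

Lemma tjet_inv k c : smooth_curve c ->
  tjet k (fun t => linv (c t)) = linv (tjet k c).
Proof.
move=> sc; apply: (linv_uniq (pT k)); have si := smooth_curve_inv pG sc.
rewrite -tjet_mul // -tjet1; congr tjet; apply/funext => t.
exact: pl_mulV.
Qed.

(** A transition map of [J^k G] is [tlift], followed by a transition map of [T^k G], followed by
    [tretract]; the outer two are linear. *)
Lemma jet_lie_premanifold k : premanifold (jet_manifold k G).
Proof.
apply: jet_premanifold => //; first exact: jet_invariant_lie.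
move=> X _ [[phi aphi <-] sX].
set z0 := chart_map _ X => _ [[psi apsi <-]].
have cX : charts_at (jet_rep X 0) phi by split.
have Ez0 : row ord0 (vec_mx z0) = chart_map phi (jet_rep X 0) by
  rewrite /z0 /= row_mxvecK.
have srow : smooth (fun z : 'rV[R]_(k.+1 * mdim G) => row ord0 (vec_mx z)) z0.
  by apply: smooth_row; exact: smooth_id.
have tz0 : \forall z \near z0, target phi (row ord0 (vec_mx z)).
  by apply: (smooth_continuous srow); rewrite /= Ez0; exact: near_target.
have spsi : source psi (param phi (row ord0 (vec_mx z0))) -> 
    \forall z \near z0, source psi (param phi (row ord0 (vec_mx z))).
  move=> sp; rewrite Ez0 in sp;
    have [src _] := pm_transition pM cX (conj apsi sp).
  rewrite -Ez0 in src; exact: (smooth_continuous srow src).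
rewrite jet_paramE => sz0.
have scz (z : 'rV[R]_(k.+1 * mdim G)) : target phi (row ord0 (vec_mx z)) ->
  smooth_curve (jet_curve phi z).
  by move=> tz; exact: smooth_jet_curve tz.
have cz (z : 'rV[R]_(k.+1 * mdim G)) : target phi (row ord0 (vec_mx z)) ->
  charts_at (jet_curve phi z 0) phi.
  by move=> tz; exact: jet_curve_chart tz.
have tz00 := nbhs_singleton tz0.
have {}sz0 : source psi (param phi (row ord0 (vec_mx z0))).
  by move: sz0; rewrite /= jet_rep_of0 ?jet_curve0 //; exact: scz.
have nsrc := spsi sz0; split.
  apply: filterS2 tz0 nsrc => z tz sz; rewrite jet_paramE.
  by rewrite /= jet_rep_of0 ?jet_curve0 //; exact: scz.
pose rows (z : 'rV[R]_(k.+1 * mdim G)) i := row (inord i : 'I_k.+1) (vec_mx z).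
have srows : smooth (fun z => tlift k (rows z)) z0.
  apply: (@smooth_tlift _ _ _ k (fun i z => rows z i)) => i.
  by apply: smooth_row; exact: smooth_id.
have echart z : target phi (row ord0 (vec_mx z)) ->
    chart_map (tchart k phi) (tjet k (jet_curve phi z)) = tlift k (rows z).
  move=> tz; rewrite tjet_chart; [|exact: scz|exact: cz].
  by apply: eq_tlift => i ik; rewrite derive_jet_curve.
have ct := tjet_charts_at k (scz _ tz00) (cz _ tz00).
have cpsi0 : charts_at (jet_curve phi z0 0) psi by rewrite jet_curve0.
have ct' := tjet_charts_at k (scz _ tz00) cpsi0.
have := pm_transition (pTM k) ct; rewrite echart // => /(_ (tchart k psi)).
rewrite -echart // (chart_paramK (pTM k) ct) => /(_ ct')[_].
rewrite echart // => strans.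
apply: smooth_eq (smooth_comp (smooth_comp srows strans)
  (@smooth_tretract _ _ k _)).
apply: filterS2 tz0 nsrc => z tz sz.
have cpsi : charts_at (jet_curve phi z 0) psi by rewrite jet_curve0; split.
rewrite -[RHS]/(chart_map (jet_chart k psi) (param (jet_chart k
  phi) z)) jet_paramE.
rewrite (jet_chart_of k (scz _ tz) cpsi).
rewrite -[LHS]/(tretract (chart_map (tchart k psi) (param (tchart k phi)
  (tlift k (rows z))))).
rewrite -echart //.
rewrite (chart_paramK (pTM k) (tjet_charts_at k (scz _ tz) (cz _ tz))).
rewrite tjet_chart //; last exact: scz.
by rewrite tretractK.
Qed.

End JetsInTangent.

(** * The right trivialization *)

Section ProductAtOne.
Context {R : realType} (H : lieGroup R).
Hypothesis pH : prelie H.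
Let pM := pl_premanifold pH.

(** The differential of the product at the unit is addition: a pair of directions splits as
    [(u, 0) + (0, v)], and each part is found by keeping the other factor constantly equal to the
    unit. *)
Lemma derive1_mul1 (c b : R -> H) phi : smooth_curve c -> smooth_curve b ->
  c 0 = lone H -> b 0 = lone H -> charts_at (lone H) phi ->
  derive1 (chart_map phi \o (fun t => lmul (c t) (b t))) 0 =
  derive1 (chart_map phi \o c) 0 + derive1 (chart_map phi \o b) 0.
Proof.
move=> sc sb c0 b0 cphi.
pose e := chart_map phi (lone H).
have cphi_c : charts_at (c 0) phi by rewrite c0.
have cphi_b : charts_at (b 0) phi by rewrite b0.
have [_ smc] := sc _ cphi_c; have [_ smb] := sb _ cphi_b.
pose f (z : 'rV[R]_(mdim H) * 'rV[R]_(mdim H)) :=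
  lmul (param phi z.1) (param phi z.2).
have fe : f (e, e) = lone H by rewrite /f /= (chart_paramK
  pM cphi) (pl_mul1 pH).
have df : differentiable (chart_map phi \o f) (e, e).
  have := pl_smooth_mul pH cphi cphi (phi := phi); rewrite -/f -/e.
  by move=> sf; have := sf phi; rewrite fe => /(_ cphi)[_]; exact: smooth_diff.
have D (u v : R -> 'rV[R]_(mdim H)) : smooth u 0 -> smooth v 0 ->
  u 0 = e -> v 0 = e ->
    derive1 (fun t => chart_map phi (f (u t, v t))) 0 =
    'D_(derive1 u 0, derive1 v 0) (chart_map phi \o f) (e, e).
  move=> su sv u0 v0.
  rewrite -[X in derive1 X]/((chart_map phi \o f) \o (fun t => (u t, v t))).
  rewrite derive1_comp_diff.
  - by rewrite derive1_pair ?u0 ?v0 //; exact: smooth_diff.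
  - by apply: differentiable_pair; exact: smooth_diff.
  - by rewrite u0 v0.
have scst : smooth (cst e : R -> _) 0 by exact: smooth_cst.
have nc := near_param pH sc cphi_c; have nb := near_param pH sb cphi_b.
have uc : (chart_map phi \o c) 0 = e by rewrite /= c0.
have ub : (chart_map phi \o b) 0 = e by rewrite /= b0.
have e0 := D _ _ smc smb uc ub.
have e1 := D _ (cst e) smc scst uc erefl;
  have e2 := D (cst e) _ scst smb erefl ub.
rewrite !derive1_cst in e1 e2.
have -> : derive1 (chart_map phi \o (fun t => lmul (c t) (b t))) 0 =
    derive1 (fun t => chart_map phi (f ((chart_map phi \o c) t,
      (chart_map phi \o b) t))) 0.
  apply: near_eq_derive1; apply: filterS2 nc nb => t /= ec eb.
  by rewrite /f /= ec eb.
have -> : derive1 (chart_map phi \o c) 0 =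
    derive1 (fun t => chart_map phi (f ((chart_map phi \o c) t, cst e t))) 0.
  apply: near_eq_derive1; apply: filterS nc => t /= ec.
  by rewrite /f /= ec (chart_paramK pM cphi) (lmul1 pH).
have -> : derive1 (chart_map phi \o b) 0 =
    derive1 (fun t => chart_map phi (f (cst e t, (chart_map phi \o b) t))) 0.
  apply: near_eq_derive1; apply: filterS nb => t /= eb.
  by rewrite /f /= eb (chart_paramK pM cphi) (pl_mul1 pH).
rewrite e0 e1 e2 !(deriveE _ df) -linearD.
set u := derive1 _ 0; set v := derive1 _ 0.
by rewrite -[X in _ = 'd _ _ X]/(u + 0, 0 + v) addr0 add0r.
Qed.

End ProductAtOne.

Section RightTrivialization.
Context {R : realType} (G : lieGroup R).
Local Notation T k := (tangent_group G k).
Implicit Types (c b : R -> G).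
Hypothesis pG : prelie G.
Let pM := pl_premanifold pG.
Let pT k : prelie (T k) := tangent_prelie k pG.
Let pTM k : premanifold (T k) := pl_premanifold (pT k).

Lemma tchart_lone k phi : charts_at (lone G) phi ->
  charts_at (lone (T k)) (tchart k phi).
Proof.
move=> cphi; rewrite -tjet1; apply: tjet_charts_at => //.
exact: smooth_curve_cst.
Qed.

Variable phi : {phi : chart R G (mdim G) | charts_at (lone G) phi}.

(* For [A = set0] the convention of [trivialized] is replaced by the coordinates
   of the base point, which makes the recursion on [k] uniform. *)
Definition triv_coord k (A : {set 'I_k}) (v : T k) : 'rV[R]_(mdim G) :=
  if A == finset.set0 then chart_map (sval phi) (right_triv v).1
  else (right_triv v).2 A phi.

Lemma triv_coord_low k (A : {set 'I_k.+1}) (X : T k.+1) : ord_max \notin A ->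
  triv_coord A X = triv_coord (lower A) (jet_rep (X : jet 1 (T k)) 0).
Proof.
move=> nA; rewrite /triv_coord -lower0 nA andbT.
by case: ifP => //= _; rewrite nA.
Qed.

Definition delta k (C : R -> T k) : R -> T k := fun t =>
  lmul (C t) (linv (C 0)).

Lemma triv_coord_high k (A : {set 'I_k.+1}) (X : T k.+1) : ord_max \in A ->
  triv_coord A X =
  derive1 (triv_coord (lower A) \o delta (jet_rep (X : jet 1 (T k)))) 0.
Proof.
move=> mA; rewrite /triv_coord.
have /negbTE -> : A != finset.set0 by apply/set0Pn; exists ord_max.
by rewrite /= mA /=; case: ifP.
Qed.

Lemma smooth_delta k (C : R -> T k) : smooth_curve C -> smooth_curve (delta C).
Proof.
move=> sC; apply: (smooth_curve_mul (pT k)) => //.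
exact: smooth_curve_cst.
Qed.

Lemma delta0 k (C : R -> T k) : delta C 0 = lone (T k).
Proof. exact: (lmulV (pT k)). Qed.

Definition zero_vector k (p : T k) : T k.+1 := jet_of 1 (cst p : R -> T k).

Lemma zero_vector_chart k p Phi : charts_at p Phi ->
  charts_at (zero_vector p) (jet_chart 1 Phi : chart R (T k.+1) _) /\
  chart_map (jet_chart 1 Phi) (zero_vector p) =
  mxvec (\matrix_(i < 2) if i == 0 then chart_map Phi p else 0).
Proof.
move=> cp; have scp : smooth_curve (cst p : R ->
  T k) by exact: smooth_curve_cst.
split; first exact: (jet_charts_at 1 scp cp).
rewrite jet_chart_of //; congr mxvec; apply/row_matrixP => i; rewrite !rowK.
case: i => -[|[|i]] i2; last by case: (notF i2).
  by [].
by rewrite derive1n1 (derive1_cst (chart_map Phi p)).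
Qed.

(** Right translation by the inverse of [C 0] becomes, on tangent vectors, right multiplication by
    the inverse of the zero vector over [C 0]. The jet of the translated curve is thus a product in
    [T k.+1], determined by the jet of [C]. *)
Lemma jet_delta k (C : R -> T k) : smooth_curve C ->
  jet_of 1 (delta C) = lmul (jet_of 1 C : T k.+1) (linv (zero_vector (C 0))).
Proof.
move=> sC; have sZ : smooth_curve (cst (C 0) : R ->
  T k) by exact: smooth_curve_cst.
rewrite -[linv _](esym (jet_of_linv (pT k) sZ)).
apply: etrans (esym (jet_of_mul (pT k) sC _)); first by [].
exact: (smooth_curve_inv (pT k)).
Qed.

Lemma derive1_delta k (C : R -> T k) Phi : smooth_curve C ->
  charts_at (lone (T k)) Phi ->
  derive1 (chart_map Phi \o delta C) 0 =
  row 1 (vec_mx (chart_map (jet_chart 1 Phi) (jet_of 1 (delta C)))).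
Proof.
move=> sC cP; rewrite jet_chart_of ?delta0 //; last exact: smooth_delta.
by rewrite row_mxvecK.
Qed.

(** The trivialization is not linear in charts, but at the unit the two have the same derivative.
    For [A] containing [ord_max], the component of [C t] is linear in the coordinates of [C t]
    translated to the unit, and by [derive1_mul1] this translation does not affect the derivative
    being read. *)
Lemma derive1_triv_coord k (A : {set 'I_k}) (C : R -> T k) : smooth_curve C ->
  C 0 = lone (T k) ->
  derive1 (triv_coord A \o C) 0 =
  tproj A (derive1 (chart_map (tchart k (sval phi)) \o C) 0).
Proof.
elim: k A C => [|k IHk] A C sC C0.
  rewrite /= (_ : triv_coord A = chart_map (sval phi)) //.
  apply/funext => v; rewrite /triv_coord ifT //.
  by apply/eqP/setP => -[].
pose Phi := tchart k (sval phi); pose Phi' := tchart k.+1 (sval phi).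
have cPhi' : charts_at (lone (T k.+1)) Phi' by exact: tchart_lone (svalP phi).
have cPhi : charts_at (lone (T k)) Phi by exact: tchart_lone (svalP phi).
pose D t := jet_rep (C t : jet 1 (T k)) 0.
have D0 : D 0 = lone (T k).
  by rewrite /D C0 jet_rep_of0 //; exact: smooth_curve_cst.
have cC0 : charts_at (C 0) Phi' by rewrite C0.
have [srcC smC] := sC _ cC0.
have ED t : chart_map Phi (D t) = row 0 (vec_mx (chart_map Phi' (C t))).
  by rewrite /= row_mxvecK.
have sD : smooth_curve D.
  apply: (smooth_into_chart (pTM k) (phi := Phi)); first by rewrite D0.
    exact: srcC.
  rewrite (_ : _ \o D = fun t => row 0 (vec_mx (chart_map Phi' (C t)))).
    exact: smooth_row smC.
  exact/funext.
have dC := smooth_diff smC.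
have [mA|nA] := boolP (ord_max \in A); last first.
  rewrite (_ : triv_coord A \o C = triv_coord (lower A) \o D); last first.
    by apply/funext => t; exact: triv_coord_low.
  rewrite IHk // -/Phi -/Phi' /= (negbTE nA).
  pose r0 := ((row 0 \o vec_mx) : {linear 'rV[R]_(2 * mdim (T k)) ->
    'rV[R]_(mdim (T k))}).
  rewrite (_ : chart_map Phi \o D = r0 \o (chart_map Phi' \o
    C)); last exact/funext.
  by rewrite (derive1_linear r0 dC).
(* [C] factors as [E] times [Z]: [Z] is the zero section over the base curve [D], and [E] moves each
   tangent vector [C t] to the tangent space at the unit of [T k]. *)
pose Z t := zero_vector (D t).
pose E t := lmul (C t) (linv (Z t)).
have nD : \forall t \near (0 : R), charts_at (D t) Phi.
  by apply: filterS srcC => t st; split=> //; case: cPhi.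
have sZ : smooth_curve Z.
  apply: (smooth_into_chart (pTM k.+1) (phi := Phi')).
  - by rewrite /Z D0.
  - by apply: filterS nD => t /zero_vector_chart[[]].
  have [_ smD] := sD Phi (nbhs_singleton nD).
  have H : smooth (fun t : R =>
    mxvec (\matrix_(i < 2) if i == 0 then chart_map Phi (D t) else 0)) 0.
    by apply: smooth_mxvec_rows => i; case: (i == 0);
      [exact: smD|exact: smooth_cst].
  apply: smooth_eq H.
  by apply: filterS nD => t /zero_vector_chart[_ e]; rewrite [RHS]e.
have sE : smooth_curve E.
  apply: (smooth_curve_mul (pT k.+1)) => //.
  exact: (smooth_curve_inv (pT k.+1)).
have Z0 : Z 0 = lone (T k.+1) by rewrite /Z D0.
have E0 : E 0 = lone (T k.+1) by rewrite /E C0 Z0; exact: (lmulV (pT k.+1)).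
have cE0 : charts_at (E 0) Phi' by rewrite E0.
have cZ0 : charts_at (Z 0) Phi' by rewrite Z0.
have [r1 r1E] : exists r1 : {linear 'rV[R]_(2 * mdim (T k)) ->
  'rV[R]_(mdim (T k))},
  forall z, r1 z = row 1 (vec_mx z) by exists (row 1 \o vec_mx).
(* For each fixed [t], the induction hypothesis is applied to the representative of [C t] translated
   to the unit. *)
have -> : triv_coord A \o C = tproj (lower A) \o (r1 \o (chart_map Phi' \o E)).
  apply/funext => t.
  have sX : smooth_curve (jet_rep (C t : jet 1 (T k))) := jet_rep_smooth _.
  rewrite /= (triv_coord_high _ mA) (IHk _ _ (smooth_delta sX) (delta0 _)).
  rewrite -/Phi (derive1_delta sX cPhi).
  have -> : jet_of 1 (delta (jet_rep (C t : jet 1 (T k)))) = E t.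
    rewrite (jet_delta sX).
    by rewrite (jet_repK (C t : jet 1 (T k))).
  by rewrite [RHS]/= r1E.
have dE : differentiable (chart_map Phi' \o E) 0.
  by have [_ /smooth_diff] := sE _ cE0.
have dZ : differentiable (chart_map Phi' \o Z) 0.
  by have [_ /smooth_diff] := sZ _ cZ0.
have dr1 : differentiable (r1 \o (chart_map Phi' \o E)) 0.
  by apply: (differentiable_comp dE); apply: smooth_diff; exact: smooth_linear.
apply: etrans (derive1_linear (tproj (lower A)) dr1) _.
have -> : tproj A (derive1 (chart_map Phi' \o C) 0) =
    tproj (lower A) (r1 (derive1 (chart_map Phi' \o C) 0)) by rewrite /= mA r1E.
congr (tproj _ _); apply: etrans (derive1_linear r1 dE) _.
(* The direction part of a zero vector vanishes for all small [t], hence so does its derivative. *)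
have eZ : r1 (derive1 (chart_map Phi' \o Z) 0) = 0.
  apply: etrans (esym (derive1_linear r1 dZ)) _.
  apply: etrans (derive1_cst 0 0); apply: near_eq_derive1.
  apply: filterS nD => t /zero_vector_chart[_ e].
  by apply: etrans (congr1 r1 e) _; rewrite r1E row_mxvecK.
have CE t : C t = lmul (E t) (Z t) by exact: esym (lmulVK (pT k.+1) _ _).
have -> : chart_map Phi' \o C = chart_map Phi' \o (fun t => lmul (E t) (Z t)).
  by apply/funext => t; exact: (congr1 (chart_map Phi') (CE t)).
have eM := derive1_mul1 (pT k.+1) sE sZ E0 Z0 cPhi'.
apply: esym; apply: etrans (congr1 r1 eM) _.
apply: etrans (linearD r1 _ _) _.
exact: etrans (congr1 (fun x => _ + x) eZ) (addr0 _).
Qed.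

End RightTrivialization.

(** * Trivialized components of the class of a curve *)

Section SymmetricJets.
Context {R : realType} (G : lieGroup R).
Local Notation T k := (tangent_group G k).
Implicit Types (c b : R -> G).
Hypothesis pG : prelie G.
Let pM := pl_premanifold pG.
Let pT k : prelie (T k) := tangent_prelie k pG.
Let pTM k : premanifold (T k) := pl_premanifold (pT k).

Lemma right_triv_set0 k (v : T k) : (right_triv v).2 finset.set0 = 0.
Proof.
elim: k v => [//|k IHk] v /=;
  rewrite finset.in_set0 /= -[RHS](IHk (jet_rep (v : jet 1 (T k)) 0)).
by congr ((right_triv _).2 _); apply/setP => i; rewrite !inE.
Qed.

Section WithChart.
Variable phi : {phi : chart R G (mdim G) | charts_at (lone G) phi}.

Lemma derive1_triv_delta k (B : {set 'I_k}) (C : R -> T k) : smooth_curve C ->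
  derive1 (triv_coord phi B \o delta C) 0 =
  tproj B (derive1 (chart_map (tchart k (sval phi)) \o delta C) 0).
Proof.
move=> sC; apply: derive1_triv_coord => //; first exact: smooth_delta.
exact: delta0.
Qed.

(** [right_triv] uses the chosen representative of the jet. It can be exchanged for [C] because, by
    [derive1_triv_delta], the derivative depends only on the jet of [delta], which [jet_delta]
    computes from that of the curve. *)
Lemma triv_coord_jet_of k (A : {set 'I_k.+1}) (C : R -> T k) :
  smooth_curve C -> ord_max \in A ->
  triv_coord phi A (jet_of 1 C : T k.+1) =
  derive1 (triv_coord phi (lower A) \o delta C) 0.
Proof.
move=> sC mA; have cPhi := tchart_lone pG k (svalP phi).
set X : jet 1 (T k) := jet_of 1 C.
have sX : smooth_curve (jet_rep X) := jet_rep_smooth X.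
apply: etrans (triv_coord_high phi X mA) _.
apply: etrans (derive1_triv_delta _ sX) _.
apply: esym; apply: etrans (derive1_triv_delta _ sC) _; congr (tproj _ _).
apply: etrans (derive1_delta pG sC cPhi) _.
apply: esym; apply: etrans (derive1_delta pG sX cPhi) _.
have e0 : jet_rep X 0 = C 0 by exact: jet_rep_of0.
have eX : jet_of 1 (jet_rep X) = jet_of 1 C by exact: jet_repK.
have -> // : jet_of 1 (delta (jet_rep X)) = jet_of 1 (delta C).
apply: etrans (jet_delta pG sX) (etrans _ (esym (jet_delta pG sC))).
by rewrite e0 eX.
Qed.

(** The components without [ord_max] fix the base point by induction; the others fix the 1-jet of
    the translated curve, and multiplying by the zero vector undoes the translation. Equality of
    [tbase] is assumed because a chart around the unit cannot separate points of [G] outside its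
    domain. *)
Lemma triv_coord_inj k (v w : T k) : tbase v = tbase w ->
  (forall A, triv_coord phi A v = triv_coord phi A w) -> v = w.
Proof.
elim: k v w => [//|k IHk] v w E H.
have cPhi := tchart_lone pG k (svalP phi).
pose cv := jet_rep (v : jet 1 (T k)); pose cw := jet_rep (w : jet 1 (T k)).
have E0 : cv 0 = cw 0.
  apply: IHk => // B; have := H (raise false B).
  by rewrite !triv_coord_low ?raise_max // raiseK.
have sv : smooth_curve cv := jet_rep_smooth _.
have sw : smooth_curve cw := jet_rep_smooth _.
have Ed : derive1 (chart_map (tchart k (sval phi)) \o delta cv) 0 =
    derive1 (chart_map (tchart k (sval phi)) \o delta cw) 0.
  apply: tproj_inj => B.
  have mB : ord_max \in raise true B by rewrite raise_max.
  apply: etrans (esym (derive1_triv_delta B sv)) (etrans _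
    (derive1_triv_delta B sw)).
  have := etrans (esym (triv_coord_high phi v mB)) (etrans (H _)
    (triv_coord_high phi w mB)).
  by rewrite raiseK.
have J : jet_of 1 (delta cv) = jet_of 1 (delta cw).
  have sdv := smooth_delta pG sv; have sdw := smooth_delta pG sw.
  apply: jet_of_eq => //;
    apply: (jet1_invariant (pTM k) sdv sdw _ (phi := tchart k (sval phi))).
  - exact: etrans (delta0 pG cv) (esym (delta0 pG cw)).
  - by rewrite (delta0 pG cv).
  case=> [|[|i]] i1; last by case: (notF i1).
    exact: congr1 (etrans (delta0 pG cv) (esym (delta0 pG cw))).
  exact: Ed.
have J' : lmul v (linv (zero_vector (cv 0))) = lmul w (linv
  (zero_vector (cv 0))).
  have := etrans (esym (jet_delta pG sv)) (etrans J (jet_delta pG sw)).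
  by rewrite -E0 (jet_repK (v : jet 1 (T k))) (jet_repK (w : jet 1 (T k))).
by rewrite -(lmulVK (pT k.+1) v (zero_vector (cv 0))) J' (lmulVK (pT k.+1)).
Qed.

(* For [0 < m], the derivative of order [m - 1] of [c' c^-1] at [0]. Its recursion
   mirrors [right_triv], so that no exchange of partial derivatives is needed. *)
Fixpoint log_derivative m c : 'rV[R]_(mdim G) :=
  match m with
  | 0 => chart_map (sval phi) (c 0)
  | n.+1 => derive1 (fun t => log_derivative n (fun s =>
    lmul (c (t + s)) (linv (c s)))) 0
  end.

(** A tangent step outside [A] leaves the curve [c] as it is, and a step in [A] replaces it by
    [c (t + s) * (c s)^-1] and differentiates in [t]; only the number of steps of the second kind
    matters. *)
Lemma triv_coord_tjet k (A : {set 'I_k}) c : smooth_curve c ->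
  triv_coord phi A (tjet k c) = log_derivative #|A| c.
Proof.
elim: k A c => [|k IHk] A c sc.
  rewrite /triv_coord ifT ?eq_card0 //; first by move=> -[].
  by apply/eqP/setP => -[].
rewrite card_lower; have [mA|nA] := boolP (ord_max \in A); last first.
  by rewrite triv_coord_low // tjet_rep_base // addn0; exact: IHk.
have sC := tjet_smooth pG (k := k) sc.
rewrite (triv_coord_jet_of sC mA) addn1 /=.
apply: near_eq_derive1; apply: filterS (near_shift_curve pG sc) => t sct.
have si := smooth_curve_inv pG sc.
rewrite -IHk; last exact: smooth_curve_mul.
rewrite /= /delta tjet_mul // tjet_inv //.
by congr (triv_coord _ _ (lmul _ (linv (tjet _ _))));
  apply/funext => s; rewrite add0r.
Qed.

End WithChart.

Lemma tjet_sym_fixed k c : smooth_curve c -> sym_fixed G k (tjet k c).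
Proof.
move=> sc s; rewrite /sym_act [RHS]surjective_pairing; congr (_, _).
apply/funext => A; apply/funext => phi.
have [->|A0] := eqVneq A finset.set0;
  first by rewrite preimset0 !right_triv_set0.
have cA := card_preimset A (@perm_inj _ s).
have sA0 : (s @^-1: A)%SET != finset.set0 by rewrite -cards_eq0 cA cards_eq0.
have := triv_coord_tjet phi (s @^-1: A)%SET sc.
by rewrite cA -(triv_coord_tjet phi A sc) /triv_coord (negbTE A0) (negbTE sA0).
Qed.

End SymmetricJets.

(** * Fixed points *)

Section FixedPoints.
Context {R : realType} (G : lieGroup R).
Local Notation T k := (tangent_group G k).
Implicit Types (c b : R -> G).
Hypothesis pG : prelie G.
Let pM := pl_premanifold pG.
Let pT k : prelie (T k) := tangent_prelie k pG.
Let pTM k : premanifold (T k) := pl_premanifold (pT k).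

Lemma raise_preim k (s : {perm 'I_k}) (B : {set 'I_k}) :
  (lift_perm ord_max ord_max s @^-1: raise false B)%SET =
  raise false (s @^-1: B)%SET.
Proof.
apply/setP => i; rewrite !inE; case: (unliftP ord_max i) => [j|] ->.
  by rewrite lift_perm_lift liftK inE.
by rewrite lift_perm_id unlift_none.
Qed.

Lemma right_triv_raise k (v : T k.+1) (B : {set 'I_k}) :
  (right_triv v).2 (raise false B) = (right_triv (jet_rep (v :
    jet 1 (T k)) 0)).2 B.
Proof. by rewrite /= raise_max /= -/(lower _) raiseK. Qed.

(** A permutation of [k] indices extends to [k.+1] by fixing [ord_max]; the extension permutes the
    components of index [raise false B], which are those of the base point. *)
Lemma sym_fixed_base k (v : T k.+1) : sym_fixed G k.+1 v ->
  sym_fixed G k (jet_rep (v : jet 1 (T k)) 0).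
Proof.
move=> sv s; rewrite /sym_act [RHS]surjective_pairing; congr (_, _).
apply/funext => B.
have key := congr1 (fun x =>
  x.2 (raise false B)) (sv (lift_perm ord_max ord_max s)).
rewrite [LHS]/= raise_preim in key.
exact: etrans (esym (right_triv_raise v _)) (etrans key (right_triv_raise v _)).
Qed.

Lemma triv_coord_sym phi k (v : T k) (s : {perm 'I_k}) (A : {set 'I_k}) :
  sym_fixed G k v -> triv_coord phi (s @^-1: A)%SET v = triv_coord phi A v.
Proof.
move=> /(_ s) /(congr1 snd) /= E; have cA := card_preimset A (@perm_inj _ s).
by rewrite /triv_coord -!cards_eq0 cA -[in RHS]E.
Qed.

(** If [j] is missing from [A], exchanging [j] with [ord_max] turns [A] into a set without
    [ord_max], whose component is read on the base point. *)
Lemma triv_coord_nonfull phi k (v w : T k.+1) (A : {set 'I_k.+1}) :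
  sym_fixed G k.+1 v -> sym_fixed G k.+1 w ->
  jet_rep (v : jet 1 (T k)) 0 = jet_rep (w : jet 1 (T k)) 0 ->
  A != [set: 'I_k.+1]%SET -> triv_coord phi A v = triv_coord phi A w.
Proof.
move=> sv sw E0 /negP nA.
have [j nj] : exists j, j \notin A.
  apply/existsP; apply: contra_notT nA; rewrite negb_exists => /forallP H.
  by apply/eqP/setP => j; rewrite inE; have := H j; rewrite negbK.
rewrite -(triv_coord_sym phi (tperm j ord_max) A sv).
rewrite -(triv_coord_sym phi (tperm j ord_max) A sw).
have nm : ord_max \notin (tperm j ord_max @^-1: A)%SET by rewrite inE tpermR.
apply: etrans (triv_coord_low phi v nm) (etrans _ (esym
  (triv_coord_low phi w nm))).
by rewrite E0.
Qed.

Lemma derive1n_cst (V : normedModType R) (a : V) i t :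
  derive1n i.+1 (cst a) t = 0.
Proof.
elim: i t => [|i IHi] t; first by rewrite derive1n1 derive1_cst.
rewrite derive1nS (_ : derive1n i.+1 _ = cst 0); last exact/funext.
exact: derive1_cst.
Qed.

Section Correction.
Variables (phi : {phi : chart R G (mdim G) | charts_at (lone G) phi}) (k : nat).
Variable u : 'rV[R]_(mdim G).

(* Multiplying a curve by [bump_curve] leaves its [k]-jet unchanged and adds [u]
   to its top component in the right trivialization ([triv_coord_bump]). *)
Definition bump_coef i : 'rV[R]_(mdim G) :=
  if i == 0%N then chart_map (sval phi) (lone G)
  else if i == k.+1 then u else 0.

Definition bump_curve : R -> G :=
  jet_curve (k := k.+1) (sval phi) (mxvec (\matrix_(i < k.+2) bump_coef i)).

Let phi1 := svalP phi.

Let tgt : target (sval phi) (row ord0 (vec_mx (mxvec (\matrix_(i <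
  k.+2) bump_coef i)))).
Proof. by rewrite row_mxvecK; exact: (chart_target pM). Qed.

Lemma smooth_bump : smooth_curve bump_curve.
Proof. by apply: smooth_jet_curve tgt => //; case: phi1. Qed.

Lemma bump0 : bump_curve 0 = lone G.
Proof. by rewrite /bump_curve jet_curve0 row_mxvecK;
  exact: (chart_paramK pM). Qed.

Lemma derive_bump i : (i <= k.+1)%N ->
  derive1n i (chart_map (sval phi) \o bump_curve) 0 = bump_coef i.
Proof.
move=> ik; rewrite /bump_curve derive_jet_curve //; last by case: phi1.
by rewrite row_mxvecK inordK.
Qed.

Lemma tjet_bump : tjet k bump_curve = lone (T k).
Proof.
have c1 : charts_at (bump_curve 0) (sval phi) by rewrite bump0.
rewrite -tjet1; apply: (tjet_eq pG smooth_bump _ _ c1).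
- exact: smooth_curve_cst.
- exact: bump0.
move=> i ik; rewrite derive_bump ?(leq_trans ik) // /bump_coef.
case: i ik => [|i] ik; first by [].
rewrite ifF ?ifF //; last by apply/eqP => E; rewrite E ltnn in ik.
exact: esym (derive1n_cst (chart_map (sval phi) (lone G)) i 0).
Qed.

(** The lifted bump curve starts at the unit, so translating the product to the unit affects only
    the second factor; [derive1_mul1] then adds the two velocities. *)
Lemma triv_coord_bump c : smooth_curve c ->
  triv_coord phi [set: 'I_k.+1]%SET (tjet k.+1 (fun t =>
    lmul (bump_curve t) (c t))) =
  u + triv_coord phi [set: 'I_k.+1]%SET (tjet k.+1 c).
Proof.
move=> sc; have sb := smooth_bump; have sbc := smooth_curve_mul pG sb sc.
have mT : ord_max \in [set: 'I_k.+1]%SET by rewrite inE.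
pose Phi := tchart k (sval phi); pose B := lower [set: 'I_k.+1]%SET.
have cPhi : charts_at (lone (T k)) Phi by exact: tchart_lone.
have lE b : smooth_curve b ->
    triv_coord phi [set: 'I_k.+1]%SET (tjet k.+1 b) =
    tproj B (derive1 (chart_map Phi \o delta (fun t =>
      tjet k (fun s => b (t + s)))) 0).
  move=> sb'; have sB := tjet_smooth pG (k := k) sb'.
  exact: etrans (triv_coord_jet_of pG phi sB mT)
    (derive1_triv_delta pG phi B sB).
rewrite !lE //.
pose H t := tjet k (fun s => bump_curve (t + s)).
pose C t := tjet k (fun s => c (t + s)).
have sH : smooth_curve H by exact: tjet_smooth.
have sC : smooth_curve C by exact: tjet_smooth.
have H0 : H 0 = lone (T k).
  by rewrite -tjet_bump; congr tjet; apply/funext => s; rewrite add0r.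
have cH0 : charts_at (H 0) Phi by rewrite H0.
pose C' t := tjet k (fun s => lmul (bump_curve (t + s)) (c (t + s))).
have C'E : \forall t \near (0 : R), C' t = lmul (H t) (C t).
  apply: filterS2 (near_shift_curve pG sb) (near_shift_curve pG sc) => t.
  exact: tjet_mul.
have C'0 : C' 0 = C 0 by rewrite (nbhs_singleton C'E) H0 (pl_mul1 (pT k)).
have -> : derive1 (chart_map Phi \o delta C') 0 =
    derive1 (chart_map Phi \o (fun t => lmul (H t) (delta C t))) 0.
  apply: near_eq_derive1; apply: filterS C'E => t e.
  by rewrite /= /delta e C'0 (pl_mulA (pT k)).
have eM := derive1_mul1 (pT k) sH (smooth_delta pG sC) H0 (delta0 pG C) cPhi.
apply: etrans (congr1 (tproj B) eM) _; apply: etrans (linearD (tproj B) _ _) _.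
congr (_ + _).
have c1 : charts_at (bump_curve 0) (sval phi) by rewrite bump0.
(* In the chart, the block of the full set is the derivative of order [k.+1] of the bump curve,
   namely [u]; unfolding [tproj] once turns it into the [B]-block of the velocity of [H]. *)
have := congr1 (tproj [set: 'I_k.+1]%SET) (tjet_chart pG k.+1 sb c1).
rewrite tprojK cardsT card_ord derive_bump // /bump_coef /= eqxx inE => <-.
rewrite -/B; congr (tproj B _).
have := jet_chart_of 1 sH cH0 => /(congr1 (fun z => row 1 (vec_mx z))) ->.
by rewrite row_mxvecK.
Qed.

End Correction.

Lemma sym_fixed_tjet k (v : T k) : sym_fixed G k v ->
  exists2 c, smooth_curve c & tjet k c = v.
Proof.
elim: k v => [v _|k IHk v sv].
  by exists (cst v) => //; exact: smooth_curve_cst.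
have [c sc Ec] := IHk _ (sym_fixed_base sv).
(* Lie algebra elements are families over all charts at the unit, but [triv_coord_inj] detects
   equality in a single one. *)
have [phi0 cphi0] := pm_cover pM (lone G).
pose phi : {phi : chart R G (mdim G) | charts_at (lone G) phi}
  := exist _ phi0 cphi0.
pose full := [set: 'I_k.+1]%SET.
(* The defect of the top component, which the bump curve adds back. *)
pose u := triv_coord phi full v - triv_coord phi full (tjet k.+1 c).
pose h := bump_curve phi k u.
have sh : smooth_curve h by exact: smooth_bump.
have shc : smooth_curve (fun t => lmul (h t) (c t)) by exact: smooth_curve_mul.
exists (fun t => lmul (h t) (c t)) => //.
set w := tjet _ _.
have Ew : jet_rep (w : jet 1 (T k)) 0 = jet_rep (v : jet 1 (T k)) 0.
  apply: etrans (tjet_rep_base pG k shc) _.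
  by rewrite -Ec tjet_mul // tjet_bump (pl_mul1 (pT k)).
apply: (triv_coord_inj pG (phi := phi)).
  by rewrite [LHS]/= [RHS]/= Ew.
move=> A; have [->|nA] := eqVneq A full.
  by rewrite triv_coord_bump // /u subrK.
have sw : sym_fixed G k.+1 w by exact: tjet_sym_fixed.
exact: triv_coord_nonfull sw sv Ew nA.
Qed.

End FixedPoints.

(** * Isomorphism of the jet group with the fixed points *)

Section JetEmbedding.
Context {R : realType} (G : lieGroup R) (k : nat).
Local Notation T k := (tangent_group G k).
Hypothesis pG : prelie G.
Let pM := pl_premanifold pG.
Let pT : prelie (T k) := tangent_prelie k pG.
Let pTM : premanifold (T k) := pl_premanifold pT.
Let pJ : premanifold (jet_manifold k G) := jet_lie_premanifold pG k.

(* The jet of [c] is sent to the class of [c (t_1 + .. + t_k)]. *)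
Definition jet_embed (X : jet_group k G) : T k := tjet k (jet_rep X).

Lemma jet_embed_of c : smooth_curve c -> jet_embed (jet_of k c) = tjet k c.
Proof.
move=> sc; apply: tjet_same_jet => //; first exact: jet_rep_smooth.
exact: jet_rep_of.
Qed.

Lemma jet_embed_inj : injective jet_embed.
Proof.
move=> X Y E; rewrite -[X]jet_repK -[Y]jet_repK.
apply: jet_of_eq; [exact: jet_rep_smooth|exact: jet_rep_smooth|].
by apply: (tjet_inj pG) E; exact: jet_rep_smooth.
Qed.

Lemma jet_embedM : {morph jet_embed : p q / lmul p q >-> lmul p q}.
Proof.
move=> X Y; have sX := jet_rep_smooth X; have sY := jet_rep_smooth Y.
apply: etrans (jet_embed_of (smooth_curve_mul pG sX sY)) _.
exact: tjet_mul.
Qed.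

Lemma sym_fixedE v : sym_fixed G k v <-> exists X, jet_embed X = v.
Proof.
split=> [/(sym_fixed_tjet pG)[c sc <-]|[X <-]].
  by exists (jet_of k c); exact: jet_embed_of.
by apply: tjet_sym_fixed => //; exact: jet_rep_smooth.
Qed.

Lemma sym_fixed_subgroup : is_subgroup (sym_fixed G k).
Proof.
split.
- by rewrite -tjet1; apply: tjet_sym_fixed => //; exact: smooth_curve_cst.
- move=> v w /sym_fixedE[X <-] /sym_fixedE[Y <-]; apply/sym_fixedE.
  by exists (lmul X Y); exact: jet_embedM.
move=> v /(sym_fixed_tjet pG)[c sc <-]; rewrite -tjet_inv //.
by apply: tjet_sym_fixed => //; exact: smooth_curve_inv.
Qed.

Lemma source_tchart j phi (v : T j) : source (tchart j phi) v =
  source phi (tbase v).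
Proof. by elim: j v => [//|j IHj] v; exact: IHj. Qed.

(** In the charts induced by the same [phi] on both sides, the embedding is the linear map
    [tlift]. *)
Lemma smooth_jet_embed X : msmooth jet_embed X.
Proof.
move=> _ [[phi aphi <-] sX]; set z0 := chart_map _ X.
have cX : charts_at (jet_rep X 0) phi by split.
have nt : \forall z \near z0, target (jet_chart k phi) z.
  by apply: (near_target pJ); split=> //; exists phi.
have sz (z : 'rV[R]_(k.+1 * mdim G)) : target (jet_chart k phi) z ->
  smooth_curve (jet_curve phi z).
  by move=> tz; exact: smooth_jet_curve.
have Ez (z : 'rV[R]_(k.+1 * mdim G)) : target (jet_chart k phi) z ->
    jet_embed (param (jet_chart k phi) z) = tjet k (jet_curve phi z).
  by move=> tz; rewrite jet_paramE; exact: (jet_embed_of (sz _ tz)).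
have cz (z : 'rV[R]_(k.+1 * mdim G)) : target (jet_chart k phi) z ->
    charts_at (jet_curve phi z 0) phi.
  by move=> tz; exact: jet_curve_chart.
have tz0 := nbhs_singleton nt.
apply: (smooth_into_eq (f := fun z => tjet k (jet_curve phi z))).
  by apply: filterS nt => z tz;
    rewrite -[RHS]/(jet_embed (param (jet_chart k phi) z)) Ez.
apply: (smooth_into_chart pTM (phi := tchart k phi)).
- exact: (tjet_charts_at pG k (sz _ tz0) (cz _ tz0)).
- by apply: filterS nt => z tz;
  have [] := tjet_charts_at pG k (sz _ tz) (cz _ tz).
pose rows (z : 'rV[R]_(k.+1 * mdim G)) i := row (inord i : 'I_k.+1) (vec_mx z).
have srows : smooth (fun z => tlift k (rows z)) z0.
  apply: (@smooth_tlift _ _ _ k (fun i z => rows z i)) => i.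
  by apply: smooth_row; exact: smooth_id.
apply: smooth_eq srows; apply: filterS nt => z tz.
apply: esym; apply: etrans (tjet_chart pG k (sz _ tz) (cz _ tz)) _.
by apply: eq_tlift => i ik; rewrite derive_jet_curve.
Qed.

Lemma tretract_embed X phi : charts_at (jet_rep X 0) phi ->
  tretract (chart_map (tchart k phi) (jet_embed X)) = chart_map
    (jet_chart k phi) X.
Proof.
move=> cX; rewrite /jet_embed (tjet_chart pG k (jet_rep_smooth X) cX).
exact: tretractK.
Qed.

(** Near a fixed point the inverse extends to all of [T^k G]: in charts the extension [F] is
    [tretract], which undoes [tlift] on the image. *)
Lemma smooth_jet_embed_inv (g : T k -> jet_group k G) :
  cancel jet_embed g -> msmooth_on (sym_fixed G k) g.
Proof.
move=> fK v /sym_fixedE[X <-]; have sX := jet_rep_smooth X.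
have [phi cX] := pm_cover pM (jet_rep X 0).
have cPhi : charts_at (jet_embed X) (tchart k phi) by exact: tjet_charts_at.
pose F (w : T k) : jet_group k G :=
  param (jet_chart k phi) (tretract (chart_map (tchart k phi) w)).
exists F, (source (tchart k phi)); split.
- move=> Psi cPsi.
  have := pm_transition pTM cPsi => /(_ (tchart k phi)).
  rewrite (chart_paramK pTM cPsi) => /(_ cPhi)[_ st].
  have st' : smooth (@tretract _ G k \o (chart_map (tchart k phi) \o param Psi))
      (chart_map Psi (jet_embed X)).
    by apply: (smooth_comp st); exact: smooth_tretract.
  have H := @smooth_into_comp _ (jet_manifold k G) _ _ _ _ (param
    (jet_chart k phi)) _ st'.
  apply: H.
  rewrite -[X in smooth_into _ X]/(tretract (chart_map (tchart k phi)
    (param Psi (chart_map Psi (jet_embed X))))).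
  rewrite (chart_paramK pTM cPsi) tretract_embed //.
  by apply: (pm_transition pJ); split; [exists phi => //; case: cX|case: cX].
- by apply: (mopen_source pTM); case: cPhi.
- by case: cPhi.
move=> w; rewrite in_setE => -[sw /sym_fixedE[Y EY]].
rewrite -EY in sw *; rewrite fK.
(* The domain of [tchart k phi] is decided by the base point, which is that of the jet [Y]. *)
have cY : charts_at (jet_rep Y 0) phi.
  split; first by case: cX.
  by move: sw; rewrite source_tchart tbase_tjet //; exact: jet_rep_smooth.
rewrite /F tretract_embed //.
by apply: (chart_paramK pJ); split; [exists phi => //; case: cX|case: cY].
Qed.

Lemma jet_embed_isomorphism :
  lie_isomorphic_to_subgroup (jet_group k G) (sym_fixed G k).
Proof.
(* Off the image the value is an arbitrary default; cancellation and [msmooth_on] are tested on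
   fixed points. *)
pose g v := match pselect (exists X, jet_embed X = v) with
  | left h => sval (cid h)
  | right _ => lone (jet_group k G)
  end.
have gK v : sym_fixed G k v -> jet_embed (g v) = v.
  by rewrite /g => /sym_fixedE h; case: pselect => // h'; exact: svalP (cid h').
have symE X : sym_fixed G k (jet_embed X) by apply/sym_fixedE; exists X.
have fK : cancel jet_embed g by move=> X; apply: jet_embed_inj; exact: gK.
exists jet_embed, g; split=> //.
- exact: jet_embedM.
- by move=> v; rewrite in_setE; exact: gK.
by split; [exact: smooth_jet_embed|exact: smooth_jet_embed_inv].
Qed.

End JetEmbedding.

Theorem proposition3p3 (R : realType) (G : lieGroup R) (k : nat)
    (hG : is_lie_group G) (hk : (1 <= k)%N) :
  is_subgroup (sym_fixed G k) /\
  lie_isomorphic_to_subgroup (jet_group k G) (sym_fixed G k).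
Proof.
split; first exact: sym_fixed_subgroup (lie_pre hG).
exact: jet_embed_isomorphism (lie_pre hG).
Qed.
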